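(* Let $k\ge 0$ and let $Z\in\mathbf{Rel}^{k}\mathbf{Cat}$. If $Z$ admits a strict $3$-arrow calculus, then $Z$ has property $C_{3}$.
   Context: **$k$-relative categories.** For $k\ge 0$, a (small) $k$-relative category $C=(aC,v_{1}C,\dots,v_{k}C,wC)$ consists of a small category $aC$ and subcategories $v_{1}C,\dots,v_{k}C,wC\subset aC$, each containing all objects of $aC$, with $wC\subset v_{i}C$ for all $i$, such that (for $k\ge 1$) every map of $aC$ is a finite composition of maps in the $v_{i}C$, and every relation in $aC$ is a consequence of the relations in the $v_{i}C$ and the commutativity in $aC$ of squares $y_{2}x_{1}=x_{2}y_{1}$ with $x_{1},x_{2}\in v_{i}C$, $y_{1},y_{2}\in v_{j}C$, $i<j$; for $k=0$ one requires $aC=wC$. The maps of $wC$ are the weak equivalences of $C$. A relative functor $C\to D$ is a functor $aC\to aD$ sending $wC$ into $wD$ and each $v_{i}C$ into $v_{i}D$. $\mathbf{Rel}^{k}\mathbf{Cat}$ is the category of small $k$-relative categories and relative functors. For $k=1$ these are the relative categories $(C,wC)$ (a category with a subcategory $wC$ containing all objects). For $k=0$ it is isomorphic to the category of small categories (regarded as having all maps as weak equivalences) and is denoted $\widehat{\mathbf{Cat}}$; a map of $\widehat{\mathbf{Cat}}$ is a weak equivalence if its nerve is a weak homotopy equivalence. **Strict 3-arrow calculi.** A relative category $(C,wC)$ admits a $3$-arrow calculus if there exist subcategories $U,V\subset wC$ such that (i) for every map $u\in U$ its pushouts in $C$ exist and are again in $U$, (ii) for every map $v\in V$ its pullbacks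 in $C$ exist and are again in $V$, and (iii) the maps $w\in wC$ admit a functorial factorization $w=vu$ with $u\in U$ and $v\in V$. It restricts to a $3$-arrow calculus on $(D,wC)$, where $wC\subset D\subset C$, if the same data form a $3$-arrow calculus on $(D,wC)$. A strict $3$-arrow calculus on a relative category $(C,wC)$ is a $3$-arrow calculus which restricts to one on $(wC,wC)$; another way of saying this is that in addition every pushout of a map in $wC$ along a map in $U$ is again in $wC$ and every pullback of a map in $wC$ along a map in $V$ is again in $wC$. A strict $3$-arrow calculus on a $k$-relative category $C$ is a $3$-arrow calculus on $(aC,wC)$ which restricts to a $3$-arrow calculus on $(wC,wC)$ and on $(v_{i}C,wC)$ for all $1\le i\le k$. **Property $C_3$.** For a small category $W\in\widehat{\mathbf{Cat}}$ and objects $b,c\in W$, let $(b\downarrow_{3}c)$ be the category whose objects are the zigzags $b=Z_{3}\to Z_{2}\leftarrow Z_{1}\to Z_{0}=c$ in $W$ and whose maps are the commutative ladders between such zigzags which are the identity on $b$ and on $c$. $W$ has property $C_{3}$ if for every object $b$ and every map $z\colon c\to c'$ of $W$ the functor $(b\downarrow_{3}c)\to(b\downarrow_{3}c')$ given by composition with $z$ is a weak equivalence (i.e. the functor from the terminal category to $W$ with value $b$ has property $B_{3}$). For $Z\in\mathbf{Rel}^{k}\mathbf{Cat}$ and $p_{*}=(p_{k},\dots,p_{1})$, let $w_{p_{*}}Z\in\widehat{\mathbf{Cat}}$ be the category whose objects are the relative functors $\mathbf p_{k}^{v_{k}}\times\cdots\times\mathbf p_{1}^{v_{1}}\to Z$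 and whose maps are the natural transformations between them with components in $wZ$; here $\mathbf p$ is the category $0\to\cdots\to p$, and $\mathbf p^{v_{i}}$ has $a=v_{i}=\mathbf p$ and has only identity maps in $w$ and in $v_{j}$, $j\ne i$. $Z\in\mathbf{Rel}^{k}\mathbf{Cat}$ has property $C_{3}$ if, for every $k$-fold dimension $p_{*}$, the category $w_{p_{*}}Z$ has property $C_{3}$ (for $k=0$: if $Z$ itself has property $C_3$). *)

(* Defs.v *)
From HB Require Import structures.
From Stdlib Require Import Relations.
From mathcomp Require Import all_boot all_order all_algebra generic_quotient.
From mathcomp Require Import all_classical all_reals topology normedtype.

Set Implicit Arguments.
Unset Strict Implicit.
Unset Printing Implicit Defensive.
Import Order.TTheory GRing.Theory Num.Theory.
Import numFieldNormedType.Exports.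
Local Open Scope classical_set_scope.
Local Open Scope ring_scope.
Local Open Scope quotient_scope.

Reserved Notation "g \oc f" (at level 40, left associativity).

Record category := Category {
  ob :> Type;
  hom : ob -> ob -> Type;
  idm : forall a, hom a a;
  compm : forall a b c, hom b c -> hom a b -> hom a c;
  compm1 : forall a b (f : hom a b), compm f (idm a) = f;
  comp1m : forall a b (f : hom a b), compm (idm b) f = f;
  compmA : forall a b c d (h : hom c d) (g : hom b c) (f : hom a b),
    compm h (compm g f) = compm (compm h g) f }.

Arguments hom {_} _ _.
Arguments idm {_} a.
Arguments compm {_ _ _ _} _ _.

Notation "g \oc f" := (compm g f).

Record functor (C D : category) := Functor {
  fob :> C -> D;
  fmap : forall a b, hom a b -> hom (fob a) (fob b);
  fmap1 : forall a, fmap (idm a) = idm (fob a);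
  fmapM : forall a b c (g : hom b c) (f : hom a b),
    fmap (g \oc f) = fmap g \oc fmap f }.

Arguments fmap {C D} _ {a b} _.

Definition id_functor (C : category) : functor C C :=
  @Functor C C id (fun _ _ f => f) (fun=> erefl) (fun _ _ _ _ _ => erefl).

Lemma comp_functor1 (C D E : category) (G : functor D E) (F : functor C D) a :
  fmap G (fmap F (idm a)) = idm (G (F a)).
Proof. by rewrite !fmap1. Qed.

Lemma comp_functorM (C D E : category) (G : functor D E) (F : functor C D)
    a b c (g : hom b c) (f : hom a b) :
  fmap G (fmap F (g \oc f)) = fmap G (fmap F g) \oc fmap G (fmap F f).
Proof. by rewrite !fmapM. Qed.

Definition comp_functor (C D E : category) (G : functor D E) (F : functor C D) :
    functor C E :=
  Functor (comp_functor1 G F) (@comp_functorM _ _ _ G F).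

(* The category 0 -> ... -> n: a map i -> j is a (unique) proof of i <= j. *)
Definition ordcat (n : nat) : category.
Proof.
refine (@Category 'I_n.+1 (fun i j => (i <= j)%N : Prop)
  (fun i => leqnn i) (fun i j k jk ij => leq_trans ij jk) _ _ _);
by move=> *; exact: bool_irrelevance.
Defined.

Record wide_subcat (C : category) := WideSubcat {
  msub : forall a b : C, hom a b -> Prop;
  msub1 : forall a, msub (idm a);
  msubM : forall a b c (g : hom b c) (f : hom a b),
    msub g -> msub f -> msub (g \oc f) }.

Arguments msub {C} _ {a b} _.

Definition full_subcat (C : category) : wide_subcat C :=
  @WideSubcat C (fun _ _ _ => True) (fun=> I) (fun _ _ _ _ _ _ _ => I).

Inductive is_identity (C : category) : forall a b : C, hom a b -> Prop :=
  IsIdentity a : is_identity (idm a).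

Lemma is_identityM (C : category) (a b c : C) (g : hom b c) (f : hom a b) :
  is_identity g -> is_identity f -> is_identity (g \oc f).
Proof. by move=> idg; case: idg f => b' f idf; rewrite comp1m. Qed.

Definition discrete_subcat (C : category) : wide_subcat C :=
  WideSubcat (@IsIdentity C) (@is_identityM C).

Section Squares.
Variables (C : category) (D : wide_subcat C).

(* [f' \oc u = u' \oc f] is a pushout square of the category D. *)
Definition is_pushout_in (a b c d : C) (u : hom a b) (f : hom a c)
    (f' : hom b d) (u' : hom c d) : Prop :=
  [/\ msub D u /\ msub D f, msub D f' /\ msub D u', f' \oc u = u' \oc f &
    forall (e : C) (g : hom b e) (h : hom c e),
      msub D g -> msub D h -> g \oc u = h \oc f ->
      exists! m : hom d e, [/\ msub D m, m \oc f' = g & m \oc u' = h]].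

(* [v \oc f' = f \oc v'] is a pullback square of the category D. *)
Definition is_pullback_in (a b c d : C) (v : hom b d) (f : hom c d)
    (f' : hom a b) (v' : hom a c) : Prop :=
  [/\ msub D v /\ msub D f, msub D f' /\ msub D v', v \oc f' = f \oc v' &
    forall (e : C) (g : hom e b) (h : hom e c),
      msub D g -> msub D h -> v \oc g = f \oc h ->
      exists! m : hom e a, [/\ msub D m, f' \oc m = g & v' \oc m = h]].

End Squares.

(* [vC i], for i in 'I_k, is the subcategory v_{i+1}C. *)
Record krel_data (k : nat) := KRelData {
  aC :> category;
  vC : 'I_k -> wide_subcat aC;
  wC : wide_subcat aC }.

Arguments vC {k} _ _.
Arguments wC {k} _.

Section KRelAxioms.
Variables (k : nat) (X : krel_data k).

(* Formal composites of maps of the v_i; the head of the word is applied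
   first. *)
Inductive vword : X -> X -> Type :=
| VNil a : vword a a
| VCons a b c (i : 'I_k) (f : hom a b) : msub (vC X i) f ->
    vword b c -> vword a c.

Fixpoint vword_comp a b (p : vword a b) : hom a b :=
  match p with
  | VNil a => idm a
  | VCons _ _ _ _ f _ q => vword_comp q \oc f
  end.

(* The congruence generated by the relations of the v_i (identities and
   composites) and by the commutative squares.  A map lying in both v_i and v_j
   gives the same letter in either: take two sides of the square to be
   identities. *)
Inductive vword_rel : forall a b, vword a b -> vword a b -> Prop :=
| VRefl a b (p : vword a b) : vword_rel p p
| VSym a b (p q : vword a b) : vword_rel p q -> vword_rel q p
| VTrans a b (p q r : vword a b) :
    vword_rel p q -> vword_rel q r -> vword_rel p r
| VCong a b c i (f : hom a b) (vf : msub (vC X i) f) (p q : vword b c) :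
    vword_rel p q -> vword_rel (VCons vf p) (VCons vf q)
| VId a b i (v1 : msub (vC X i) (idm a)) (p : vword a b) :
    vword_rel (VCons v1 p) p
| VComp a b c d i (f : hom a b) (g : hom b c) (vf : msub (vC X i) f)
    (vg : msub (vC X i) g) (vgf : msub (vC X i) (g \oc f)) (p : vword c d) :
    vword_rel (VCons vf (VCons vg p)) (VCons vgf p)
| VSquare a b c d e (i j : 'I_k) (x1 : hom a b) (y2 : hom b d)
    (y1 : hom a c) (x2 : hom c d)
    (vx1 : msub (vC X i) x1) (vx2 : msub (vC X i) x2)
    (vy1 : msub (vC X j) y1) (vy2 : msub (vC X j) y2) (p : vword d e) :
    (i < j)%N -> y2 \oc x1 = x2 \oc y1 ->
    vword_rel (VCons vx1 (VCons vy2 p)) (VCons vy1 (VCons vx2 p)).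

Definition is_krelcat : Prop :=
  [/\ forall i (a b : X) (f : hom a b), msub (wC X) f -> msub (vC X i) f,
      k = 0%N -> forall (a b : X) (f : hom a b), msub (wC X) f,
      (0 < k)%N -> forall (a b : X) (f : hom a b),
        exists p : vword a b, vword_comp p = f &
      (0 < k)%N -> forall (a b : X) (p q : vword a b),
        vword_comp p = vword_comp q -> vword_rel p q].

End KRelAxioms.

Record krelcat (k : nat) := KRelCat {
  krel_of :> krel_data k;
  krelcatP : is_krelcat krel_of }.

Record relfunctor (k : nat) (X Y : krel_data k) := RelFunctor {
  rel_fun :> functor X Y;
  rel_fun_w : forall (a b : X) (f : hom a b),
    msub (wC X) f -> msub (wC Y) (fmap rel_fun f);
  rel_fun_v : forall i (a b : X) (f : hom a b),
    msub (vC X i) f -> msub (vC Y i) (fmap rel_fun f) }.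

Definition prod_category (I : Type) (C : I -> category) : category.
Proof.
refine (@Category (forall i, C i) (fun a b => forall i, hom (a i) (b i))
  (fun a i => idm (a i)) (fun a b c g f i => g i \oc f i) _ _ _).
- by move=> a b f; apply: functional_extensionality_dep => i; rewrite compm1.
- by move=> a b f; apply: functional_extensionality_dep => i; rewrite comp1m.
- move=> a b c d h g f; apply: functional_extensionality_dep => i.
  by rewrite compmA.
Defined.

Definition prod_subcat (I : Type) (C : I -> category)
    (D : forall i, wide_subcat (C i)) : wide_subcat (prod_category C).
Proof.
refine (@WideSubcat (prod_category C)
  (fun a b f => forall i, msub (D i) (f i)) _ _).
- by move=> a i; exact: msub1.
- by move=> a b c g f Dg Df i; exact: msubM.
Defined.

Definition prod_krel (k : nat) (I : Type) (X : I -> krel_data k) : krel_data k :=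
  @KRelData k (prod_category X)
    (fun j => prod_subcat (fun i => vC (X i) j))
    (prod_subcat (fun i => wC (X i))).

Definition ord_krel (k : nat) (i : 'I_k) (p : nat) : krel_data k :=
  @KRelData k (ordcat p)
    (fun j => if j == i then full_subcat (ordcat p)
              else discrete_subcat (ordcat p))
    (discrete_subcat (ordcat p)).

Definition box_krel (k : nat) (p : 'I_k -> nat) : krel_data k :=
  prod_krel (fun i => ord_krel i (p i)).

Record wtrans (k : nat) (X Y : krel_data k) (F G : relfunctor X Y) := WTrans {
  wtr :> forall a : X, hom (F a) (G a);
  wtr_nat : forall (a b : X) (f : hom a b),
    wtr b \oc fmap F f = fmap G f \oc wtr a;
  wtr_w : forall a, msub (wC Y) (wtr a) }.

Lemma wtrans_eq (k : nat) (X Y : krel_data k) (F G : relfunctor X Y)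
  (s t : wtrans F G) : (forall a, s a = t a) -> s = t.
Proof.
case: s t => [s sn sw] [t tn tw] /= st.
have {}st : s = t by apply: functional_extensionality_dep.
subst t.
by rewrite (Prop_irrelevance sn tn) (Prop_irrelevance sw tw).
Qed.

Definition wtrans_id (k : nat) (X Y : krel_data k) (F : relfunctor X Y) :
  wtrans F F.
Proof.
refine (@WTrans _ _ _ F F (fun a => idm (F a)) _ _).
- by move=> a b f; rewrite comp1m compm1.
- by move=> a; exact: msub1.
Defined.

Definition wtrans_comp (k : nat) (X Y : krel_data k) (F G H : relfunctor X Y)
  (t : wtrans G H) (s : wtrans F G) : wtrans F H.
Proof.
refine (@WTrans _ _ _ F H (fun a => t a \oc s a) _ _).
- by move=> a b f; rewrite -compmA wtr_nat compmA wtr_nat compmA.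
- by move=> a; apply: msubM; exact: wtr_w.
Defined.

Definition wfun_category (k : nat) (X Y : krel_data k) : category.
Proof.
refine (@Category (relfunctor X Y) (@wtrans k X Y) (@wtrans_id k X Y)
  (@wtrans_comp k X Y) _ _ _).
- by move=> F G s; apply: wtrans_eq => a; exact: compm1.
- by move=> F G s; apply: wtrans_eq => a; exact: comp1m.
- by move=> F G H K u t s; apply: wtrans_eq => a; exact: compmA.
Defined.

Definition wp (k : nat) (p : 'I_k -> nat) (Z : krel_data k) : category :=
  wfun_category (box_krel p) Z.

Record functorial_factorization (C : category) (w : wide_subcat C) :=
  FunctorialFactorization {
  mid : forall (a b : C) (f : hom a b), msub w f -> C;
  mid_u : forall (a b : C) (f : hom a b) (wf : msub w f), hom a (mid wf);
  mid_v : forall (a b : C) (f : hom a b) (wf : msub w f), hom (mid wf) b;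
  mid_fact : forall (a b : C) (f : hom a b) (wf : msub w f),
    mid_v wf \oc mid_u wf = f;
  mid_map : forall (a b a' b' : C) (f : hom a b) (f' : hom a' b')
    (wf : msub w f) (wf' : msub w f') (g : hom a a') (h : hom b b'),
    f' \oc g = h \oc f -> hom (mid wf) (mid wf');
  mid_map_u : forall (a b a' b' : C) (f : hom a b) (f' : hom a' b')
    (wf : msub w f) (wf' : msub w f') (g : hom a a') (h : hom b b')
    (e : f' \oc g = h \oc f),
    mid_map wf wf' e \oc mid_u wf = mid_u wf' \oc g;
  mid_map_v : forall (a b a' b' : C) (f : hom a b) (f' : hom a' b')
    (wf : msub w f) (wf' : msub w f') (g : hom a a') (h : hom b b')
    (e : f' \oc g = h \oc f),
    mid_v wf' \oc mid_map wf wf' e = h \oc mid_v wf;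
  mid_map1 : forall (a b : C) (f : hom a b) (wf : msub w f)
    (e : f \oc idm a = idm b \oc f), mid_map wf wf e = idm (mid wf);
  mid_mapM : forall (a b a' b' a'' b'' : C) (f : hom a b) (f' : hom a' b')
    (f'' : hom a'' b'') (wf : msub w f) (wf' : msub w f') (wf'' : msub w f'')
    (g : hom a a') (h : hom b b') (g' : hom a' a'') (h' : hom b' b'')
    (e : f' \oc g = h \oc f) (e' : f'' \oc g' = h' \oc f')
    (e'' : f'' \oc (g' \oc g) = (h' \oc h) \oc f),
    mid_map wf wf'' e'' = mid_map wf' wf'' e' \oc mid_map wf wf' e }.

Section ThreeArrow.
Variables (C : category) (w U V : wide_subcat C)
  (F : functorial_factorization w).

(* U, V and F form a 3-arrow calculus on the relative category (D, w), where
   w is contained in D.  That U and V contain all the objects is no loss of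
   generality: identities are in w, hence factor through maps of U and V. *)
Record is_three_arrow_calculus (D : wide_subcat C) : Prop := {
  tac_Uw : forall (a b : C) (u : hom a b), msub U u -> msub w u;
  tac_Vw : forall (a b : C) (v : hom a b), msub V v -> msub w v;
  tac_po_ex : forall (a b c : C) (u : hom a b) (f : hom a c),
    msub U u -> msub D f ->
    exists d (f' : hom b d) (u' : hom c d), is_pushout_in D u f f' u';
  tac_po_U : forall (a b c d : C) (u : hom a b) (f : hom a c)
    (f' : hom b d) (u' : hom c d),
    msub U u -> is_pushout_in D u f f' u' -> msub U u';
  tac_pb_ex : forall (b c d : C) (v : hom b d) (f : hom c d),
    msub V v -> msub D f ->
    exists a (f' : hom a b) (v' : hom a c), is_pullback_in D v f f' v';
  tac_pb_V : forall (a b c d : C) (v : hom b d) (f : hom c d)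
    (f' : hom a b) (v' : hom a c),
    msub V v -> is_pullback_in D v f f' v' -> msub V v';
  tac_mid_u : forall (a b : C) (f : hom a b) (wf : msub w f),
    msub U (mid_u F wf);
  tac_mid_v : forall (a b : C) (f : hom a b) (wf : msub w f),
    msub V (mid_v F wf);
  tac_mid_map : forall (a b a' b' : C) (f : hom a b) (f' : hom a' b')
    (wf : msub w f) (wf' : msub w f') (g : hom a a') (h : hom b b')
    (e : f' \oc g = h \oc f),
    msub D g -> msub D h -> msub D (mid_map F wf wf' e) }.

(* The calculus on (C, w) restricts to (D, w).  The pushouts along U and the
   pullbacks along V are part of the data to be restricted: those of D have to
   be those of C.  It is this that makes a pushout in C of a map of D along a
   map of U lie again in D. *)
Definition restricts_to (D : wide_subcat C) : Prop :=
  [/\ is_three_arrow_calculus D,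
      forall (a b c d : C) (u : hom a b) (f : hom a c)
        (f' : hom b d) (u' : hom c d), msub U u ->
        is_pushout_in D u f f' u' -> is_pushout_in (full_subcat C) u f f' u' &
      forall (a b c d : C) (v : hom b d) (f : hom c d)
        (f' : hom a b) (v' : hom a c), msub V v ->
        is_pullback_in D v f f' v' -> is_pullback_in (full_subcat C) v f f' v'].

End ThreeArrow.

Definition strict_three_arrow_calculus (k : nat) (Z : krel_data k) : Prop :=
  exists (U V : wide_subcat Z) (F : functorial_factorization (wC Z)),
    [/\ is_three_arrow_calculus U V F (full_subcat Z),
        restricts_to U V F (wC Z) &
        forall i, restricts_to U V F (vC Z i)].

(* Monotone maps [m] -> [n] are functors ordcat m -> ordcat n. *)
Record sset := SSet {
  simplices :> nat -> Type;
  sact : forall m n, functor (ordcat m) (ordcat n) ->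
    simplices n -> simplices m;
  sact1 : forall n (s : simplices n), sact (id_functor (ordcat n)) s = s;
  sactM : forall l m n (th : functor (ordcat m) (ordcat n))
    (ps : functor (ordcat l) (ordcat m)) (s : simplices n),
    sact (comp_functor th ps) s = sact ps (sact th s) }.

Record smap (X Y : sset) := SMap {
  smap_fun :> forall n, X n -> Y n;
  smap_nat : forall m n (th : functor (ordcat m) (ordcat n)) (s : X n),
    smap_fun (sact th s) = sact th (smap_fun s) }.

Lemma comp_functorA (A B C D : category) (H : functor C D) (G : functor B C)
  (F : functor A B) :
  comp_functor H (comp_functor G F) = comp_functor (comp_functor H G) F.
Proof. by congr Functor; exact: Prop_irrelevance. Qed.

Lemma comp_functor_id (C D : category) (F : functor C D) :
  comp_functor F (id_functor C) = F.
Proof. by case: F => *; congr Functor; exact: Prop_irrelevance. Qed.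

Definition nerve (C : category) : sset :=
  @SSet (fun n => functor (ordcat n) C) (fun m n th s => comp_functor s th)
    (fun n s => comp_functor_id s)
    (fun l m n th ps s => comp_functorA s th ps).

Definition nerve_map (C D : category) (F : functor C D) :
    smap (nerve C) (nerve D) :=
  @SMap (nerve C) (nerve D) (fun n s => comp_functor F s)
    (fun m n th s => comp_functorA F s th).

Section Realization.
Variable R : realType.

Definition std_simplex (n : nat) : set 'rV[R]_n.+1 :=
  [set t | (forall i, 0 <= t 0 i) /\ \sum_i t 0 i = 1].

Arguments std_simplex n : clear implicits.

Definition push_row m n (th : 'I_m.+1 -> 'I_n.+1) (t : 'rV[R]_m.+1) :
    'rV[R]_n.+1 :=
  \row_j \sum_(i | th i == j) t 0 i.

Lemma push_row_simplex m n (th : 'I_m.+1 -> 'I_n.+1) (t : std_simplex m) :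
  push_row th (val t) \in std_simplex n.
Proof.
apply/mem_set; have /set_mem[t0 t1] := valP t; split=> [j|].
  by rewrite mxE; apply: sumr_ge0.
rewrite -t1 (partition_big th xpredT)//=.
by apply: eq_bigr => j _; rewrite mxE.
Qed.

Definition simplex_map m n (th : functor (ordcat m) (ordcat n))
    (t : std_simplex m) : std_simplex n :=
  exist _ (push_row th (val t)) (push_row_simplex th t).

Section Space.
Variable X : sset.

Definition cells : Type :=
  {s : {classic {n & X n}} & set_type (std_simplex (projT1 s))}.

Definition cell n (s : X n) (t : std_simplex n) : cells :=
  existT (fun s : {classic {n & X n}} => set_type (std_simplex (projT1 s)))
    (existT X n s) t.

Inductive glue : cells -> cells -> Prop :=
  Glue m n (th : functor (ordcat m) (ordcat n)) (s : X n) (t : std_simplex m) :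
    glue (cell (sact th s) t) (cell s (simplex_map th t)).

Definition cell_equiv (x y : cells) : bool :=
  `[< clos_refl_sym_trans cells glue x y >].

Lemma cell_equiv_refl : reflexive cell_equiv.
Proof. by move=> x; apply/asboolP; exact: rst_refl. Qed.

Lemma cell_equiv_sym : symmetric cell_equiv.
Proof. by move=> x y; apply/asboolP/asboolP; exact: rst_sym. Qed.

Lemma cell_equiv_trans : transitive cell_equiv.
Proof.
move=> y x z /asboolP xy /asboolP yz; apply/asboolP; exact: rst_trans xy yz.
Qed.

Definition cell_equivRel :=
  EquivRel cell_equiv cell_equiv_refl cell_equiv_sym cell_equiv_trans.

Definition realization : Type := quotient_topology {eq_quot cell_equivRel}.

End Space.

Definition cells_map (X Y : sset) (f : smap X Y) (x : cells X) : cells Y :=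
  cell (f _ (projT2 (projT1 x))) (projT2 x).

(* By [realization_mapE] below, the choice of representative is immaterial. *)
Definition realization_map (X Y : sset) (f : smap X Y)
    (x : realization X) : realization Y :=
  \pi_(realization Y) (cells_map f (repr x)).

Lemma realization_mapE (X Y : sset) (f : smap X Y) (x : cells X) :
  realization_map f (\pi x) = \pi_(realization Y) (cells_map f x).
Proof.
rewrite /realization_map; case: piP => y /eqmodP /asboolP xy.
apply/eqmodP/asboolP; elim: xy => {x y} [_ _ [m n th s t]|x|x y _|x y z _ +  _].
- rewrite /cells_map /= smap_nat; apply: rst_sym; apply: rst_step; exact: Glue.
- exact: rst_refl.
- exact: rst_sym.
- by move=> xy yz; exact: rst_trans yz xy.
Qed.

End Realization.

Section WeakHomotopyEquivalence.
Variable R : realType.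

Definition cube (n : nat) : set 'rV[R]_n :=
  [set s | forall i, 0 <= s 0 i <= 1].

Arguments cube n : clear implicits.

Definition cube_boundary (n : nat) : set 'rV[R]_n :=
  [set s | cube n s /\ exists i, s 0 i = 0 \/ s 0 i = 1].

Definition joined (T : topologicalType) (x y : T) : Prop :=
  exists2 g : R -> T, {within `[0, 1], continuous g} & g 0 = x /\ g 1 = y.

(* The elements of pi_n(T, x) are represented by the functions a satisfying
   [based_cube x a] (only their values on the cube matter), two of them
   representing the same element when they are [cube_homotopic x]. *)
Definition based_cube (T : topologicalType) (x : T) n (a : 'rV[R]_n -> T) :
    Prop :=
  {within cube n, continuous a} /\ forall s, cube_boundary s -> a s = x.

Definition cube_homotopic (T : topologicalType) (x : T) n
    (a b : 'rV[R]_n -> T) : Prop :=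
  exists h : R * 'rV[R]_n -> T,
    [/\ {within `[0, 1] `*` cube n, continuous h},
        forall s, cube n s -> h (0, s) = a s,
        forall s, cube n s -> h (1, s) = b s &
        forall t s, t \in `[0, 1] -> cube_boundary s -> h (t, s) = x].

(* f is continuous and induces bijections on path components and on
   pi_n(T, x) for all n >= 1 and all base points x. *)
Definition weak_homotopy_equivalence (T T' : topologicalType) (f : T -> T') :
    Prop :=
  [/\ continuous f,
      forall x y, joined (f x) (f y) -> joined x y,
      forall y, exists x, joined (f x) y,
      forall (n : nat) (x : T) (a b : 'rV[R]_n.+1 -> T),
        based_cube x a -> based_cube x b ->
        cube_homotopic (f x) (f \o a) (f \o b) -> cube_homotopic x a b &
      forall (n : nat) (x : T) (c : 'rV[R]_n.+1 -> T'),
        based_cube (f x) c ->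
        exists2 a, based_cube x a & cube_homotopic (f x) (f \o a) c].

Definition weak_equivalence (C D : category) (F : functor C D) : Prop :=
  weak_homotopy_equivalence (@realization_map R _ _ (nerve_map F)).

End WeakHomotopyEquivalence.

Section Zigzags.
Variables (W : category) (b : W).

Record zigzag (c : W) := Zigzag {
  zz2 : W;
  zz1 : W;
  zz32 : hom b zz2;
  zz12 : hom zz1 zz2;
  zz10 : hom zz1 c }.

Record ladder (c : W) (x y : zigzag c) := Ladder {
  lad2 : hom (zz2 x) (zz2 y);
  lad1 : hom (zz1 x) (zz1 y);
  lad32 : lad2 \oc zz32 x = zz32 y;
  lad12 : lad2 \oc zz12 x = zz12 y \oc lad1;
  lad10 : zz10 y \oc lad1 = zz10 x }.

Lemma ladder_eq (c : W) (x y : zigzag c) (l m : ladder x y) :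
  lad2 l = lad2 m -> lad1 l = lad1 m -> l = m.
Proof.
case: l m => [l2 l1 p q r] [m2 m1 p' q' r'] /= e2 e1; subst m2 m1.
by rewrite (Prop_irrelevance p p') (Prop_irrelevance q q')
  (Prop_irrelevance r r').
Qed.

Definition ladder_id (c : W) (x : zigzag c) : ladder x x.
Proof.
by apply: (@Ladder c x x (idm _) (idm _)); rewrite ?comp1m ?compm1.
Defined.

Definition ladder_comp (c : W) (x y z : zigzag c) (m : ladder y z)
  (l : ladder x y) : ladder x z.
Proof.
apply: (@Ladder c x z (lad2 m \oc lad2 l) (lad1 m \oc lad1 l)).
- by rewrite -compmA !lad32.
- by rewrite -compmA lad12 compmA lad12 compmA.
- by rewrite compmA !lad10.
Defined.

Definition zigzag_category (c : W) : category.
Proof.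
refine (@Category (zigzag c) (@ladder c) (@ladder_id c) (@ladder_comp c) _ _ _).
- by move=> x y l; apply: ladder_eq; exact: compm1.
- by move=> x y l; apply: ladder_eq; exact: comp1m.
- by move=> x y z t n m l; apply: ladder_eq; exact: compmA.
Defined.

Variables (c c' : W) (z : hom c c').

Definition zigzag_post_ob (x : zigzag c) : zigzag c' :=
  Zigzag (zz32 x) (zz12 x) (z \oc zz10 x).

Definition zigzag_post_map (x y : zigzag c) (l : ladder x y) :
  ladder (zigzag_post_ob x) (zigzag_post_ob y).
Proof.
apply: (@Ladder c' (zigzag_post_ob x) (zigzag_post_ob y) (lad2 l) (lad1 l)
  (lad32 l) (lad12 l)).
by rewrite /= -compmA lad10.
Defined.

Definition zigzag_post : functor (zigzag_category c) (zigzag_category c').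
Proof.
refine (@Functor (zigzag_category c) (zigzag_category c')
  zigzag_post_ob zigzag_post_map _ _).
- by move=> x; apply: ladder_eq.
- by move=> x y t m l; apply: ladder_eq.
Defined.

End Zigzags.

Definition cat_property_C3 (R : realType) (W : category) : Prop :=
  forall (b c c' : W) (z : hom c c'), weak_equivalence R (zigzag_post b z).

Definition property_C3 (R : realType) (k : nat) (Z : krel_data k) : Prop :=
  if k is 0 then cat_property_C3 R Z
  else forall p : 'I_k -> nat, cat_property_C3 R (wp p Z).

(* Main.v *)
From Stdlib Require Import Relations.
From mathcomp Require Import all_boot all_order all_algebra generic_quotient.
From mathcomp Require Import all_classical all_reals topology normedtype.
From mathcomp Require Import ring lra zify.
Require Import Defs.

(* Let W be a category of the form w_p Z (or Z itself if k = 0). Factorizations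
   and the pushouts along U and pullbacks along V are computed pointwise, and
   strictness keeps them inside W. Given z : c -> c' and a zigzag
   b -> Z2 <- Z1 -> c', factor Z1 -> M -> c' and form the pushout P of
   Z2 <- Z1 -> M and the pullback Q of M -> c' <- c; then b -> P <- Q -> c
   defines a functor z^* against the direction of z_*. The maps Z2 -> P, Z1 -> M and Q -> M give
   natural transformations id => z^* z_* and z_* z^* => T <= id, where T is
   b -> P <- M -> c', so z^* is a homotopy inverse of z_*.

   On realizations, a natural transformation is a simplicial homotopy. At time u
   a point t of an n-simplex is lifted to the prism over that simplex by putting
   the first u units of its mass on the bottom and the rest on top; the lift
   lies on the simplex (0,0),..,(j,0),(j,1),..,(n,1) as soon as the partial sums
   of t enclose u at j. *)

Set Implicit Arguments.
Unset Strict Implicit.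
Unset Printing Implicit Defensive.
Import Order.TTheory GRing.Theory Num.Theory numFieldNormedType.Exports.
Local Open Scope classical_set_scope.
Local Open Scope ring_scope.
Local Open Scope quotient_scope.

(** * Continuity *)

(** The map Z1 -> c' can be pulled back along z only after it has been replaced by a map in V. The
    replacement M -> c' loses the arrow to Z2, and the pushout P restores it.

    Weak equivalences are tested on based homotopy groups, while natural transformations give free
    homotopies, under which the base point travels. Both injectivity and surjectivity reduce to one
    comparison: two free homotopies with the same start and the same trace on the boundary of the
    cube have ends that are homotopic relative to the boundary.

    A realization is a quotient of a sum of arbitrarily many simplices, and continuity on its
    product with the time axis rests on the local compactness of R. The value of the homotopy must
    depend neither on the representing cell nor on j. Truncating partial sums commutes with pushing
    weights forward along monotone maps, which settles the first; at a tie the two candidate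
    simplices of the prism share a facet, which settles the second.

    Pushouts and pullbacks taken in w or in some v_i agree with the ones chosen in Z only up to
    isomorphism; this is harmless because isomorphisms are weak equivalences. *)

Lemma continuous_within_comp (X Y T : topologicalType) (A : set X) (f : X -> T)
    (g : Y -> X) :
  {within A, continuous f} -> continuous g -> (forall y, A (g y)) ->
  continuous (f \o g).
Proof.
move=> /subspace_continuousP cf cg gA y.
apply: cvg_trans (cf _ (gA y)); move=> B; rewrite !nbhs_simpl /= => fB.
have := cg y _ fB; rewrite nbhs_simpl /=.
by apply: filterS => z; apply; exact: gA.
Qed.

Lemma continuous_within_eq (X T : topologicalType) (A : set X) (f g : X -> T) :
  (forall x, A x -> f x = g x) -> continuous f -> {within A, continuous g}.
Proof.
move=> fg cf; apply: (@subspace_eq_continuous _ A _ f).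
  by move=> x /set_mem; exact: fg.
exact: continuous_subspaceT.
Qed.

Lemma continuous_comp_fun (X Y T : topologicalType) (f : X -> Y) (g : Y -> T) :
  continuous g -> continuous f -> continuous (g \o f).
Proof. by move=> cg cf x; apply: continuous_comp; [exact: cf|exact: cg]. Qed.

Lemma continuous_pair (X Y T : topologicalType) (f : T -> X) (g : T -> Y) :
  continuous f -> continuous g -> continuous (fun t => (f t, g t)).
Proof. by move=> cf cg t; apply: cvg_pair; [exact: cf|exact: cg]. Qed.

Section RealContinuity.
Variables (R : realType) (T : topologicalType).
Implicit Types f g : T -> R.

Lemma continuous_maxr f g : continuous f -> continuous g ->
  continuous (fun t => Num.max (f t) (g t)).
Proof. by move=> cf cg t; apply: continuous_max; [exact: cf|exact: cg]. Qed.

Lemma continuous_minr f g : continuous f -> continuous g ->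
  continuous (fun t => Num.min (f t) (g t)).
Proof. by move=> cf cg t; apply: continuous_min; [exact: cf|exact: cg]. Qed.

Lemma continuous_addr (V : normedModType R) (f g : T -> V) :
  continuous f -> continuous g -> continuous (fun t => f t + g t).
Proof. by move=> cf cg t; apply: cvgD; [exact: cf|exact: cg]. Qed.

Lemma continuous_oppr (V : normedModType R) (f : T -> V) :
  continuous f -> continuous (fun t => - f t).
Proof. by move=> cf t; apply: cvgN; exact: cf. Qed.

Lemma continuous_scaler (V : normedModType R) (f : T -> R) (g : T -> V) :
  continuous f -> continuous g -> continuous (fun t => f t *: g t).
Proof. by move=> cf cg t; apply: cvgZ; [exact: cf|exact: cg]. Qed.

Lemma continuous_mulr f g :
  continuous f -> continuous g -> continuous (fun t => f t * g t).
Proof. by move=> cf cg t; apply: cvgM; [exact: cf|exact: cg]. Qed.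

Lemma continuous_invr f : (forall t, f t != 0) -> continuous f ->
  continuous (fun t => (f t)^-1).
Proof. by move=> f0 cf t; apply: cvgV => //; exact: cf. Qed.

Lemma continuous_const (X : topologicalType) (c : X) :
  continuous (fun _ : T => c).
Proof. by move=> t; exact: cvg_cst. Qed.

Lemma continuous_norm (V : normedModType R) (f : T -> V) :
  continuous f -> continuous (fun t => `|f t|).
Proof. by move=> cf t; apply: cvg_norm; exact: cf. Qed.

End RealContinuity.

Definition clip01 (R : realType) (t : R) : R := Num.max 0 (Num.min 1 t).

Lemma clip01_ge0 (R : realType) (t : R) : 0 <= clip01 t.
Proof. by rewrite le_max lexx. Qed.

Lemma clip01_le1 (R : realType) (t : R) : clip01 t <= 1.
Proof. by rewrite ge_max ler01 ge_min lexx. Qed.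

Lemma clip01_id (R : realType) (t : R) : 0 <= t <= 1 -> clip01 t = t.
Proof. by case/andP=> t0 t1; rewrite /clip01 (min_idPr t1) (max_idPr t0). Qed.

Lemma clip01_continuous (R : realType) : continuous (@clip01 R).
Proof.
apply: continuous_maxr; first exact: continuous_const.
by apply: continuous_minr; [exact: continuous_const|move=> x; exact: cvg_id].
Qed.

(** The halves [d t <= c] and [c <= d t] are closed and cover T, so agreement on the level set
    [d t = c] suffices. *)
Lemma continuous_glue (T X : topologicalType) (R : realType) (d : T -> R) (c : R)
    (f g : T -> X) :
  continuous d -> continuous f -> continuous g ->
  (forall t, d t = c -> f t = g t) ->
  continuous (fun t => if d t <= c then f t else g t).
Proof.
move=> cd cf cg fg; apply/continuous_subspace_setT.
have -> : [set: T] = [set t | d t <= c] `|` [set t | c <= d t].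
  by apply/seteqP; split=> // t _ /=; apply/orP; exact: le_total.
apply: withinU_continuous.
- exact: closed_comp (fun x _ => cd x) (@closed_le R c).
- exact: closed_comp (fun x _ => cd x) (@closed_ge R c).
- by apply: continuous_within_eq cf => t /= ->.
- apply: continuous_within_eq cg => t /= ct.
  by case: ifPn => // tc; rewrite fg //; apply/le_anti; rewrite tc ct.
Qed.

(** Time runs over all of R, so that no subspace appears; a homotopy on the unit interval extends by
    clamping its time with [clip01]. *)
Definition homotopic (R : realType) (X Y : topologicalType) (f g : X -> Y) :=
  exists H : R * X -> Y, [/\ continuous H, forall x, H (0, x) = f x &
    forall x, H (1, x) = g x].

Section Homotopy.
Variable R : realType.
Variables X Y : topologicalType.
Implicit Types f g h : X -> Y.

Lemma continuous_concat (H K : R * X -> Y) :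
  continuous H -> continuous K -> (forall x, H (1, x) = K (0, x)) ->
  continuous (fun p : R * X =>
    if p.1 <= 2^-1 then H (2 * p.1, p.2) else K (2 * p.1 - 1, p.2)).
Proof.
move=> cH cK HK.
have c1 : continuous (fun p : R * X => p.1) by move=> p; exact: cvg_fst.
have c2 : continuous (fun p : R * X => p.2) by move=> p; exact: cvg_snd.
have c3 : continuous (fun p : R * X => 2 * p.1).
  by apply: continuous_mulr => //; exact: continuous_const.
apply: continuous_glue => //.
- by apply: (continuous_comp_fun cH); exact: continuous_pair.
- apply: (continuous_comp_fun cK); apply: continuous_pair => //.
  by apply: continuous_addr => //; exact: continuous_const.
- by move=> p ->; rewrite divff ?pnatr_eq0 // subrr HK.
Qed.

Lemma homotopic_sym f g : homotopic R f g -> homotopic R g f.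
Proof.
move=> [H [cH H0 H1]]; exists (fun p => H (1 - p.1, p.2)); split.
- apply: (continuous_comp_fun cH); apply: continuous_pair; last first.
    by move=> p; exact: cvg_snd.
  apply: continuous_addr; first exact: continuous_const.
  by apply: continuous_oppr => p; exact: cvg_fst.
- by move=> x /=; rewrite subr0.
- by move=> x /=; rewrite subrr.
Qed.

Lemma homotopic_trans f g h :
  homotopic R f g -> homotopic R g h -> homotopic R f h.
Proof.
move=> [H [cH H0 H1]] [K [cK K0 K1]].
exists (fun p : R * X =>
    if p.1 <= 2^-1 then H (2 * p.1, p.2) else K (2 * p.1 - 1, p.2)); split.
- by apply: continuous_concat => // x; rewrite H1 K0.
- by move=> x /=; rewrite invr_ge0 ler0n mulr0.
- move=> x /=; rewrite ifF; last by lra.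
  by rewrite -K1; congr (K (_, _)); lra.
Qed.

End Homotopy.

Section Paths.
Variables (R : realType) (T : topologicalType).

Lemma joinedP (x y : T) : joined R x y <->
  exists g : R -> T, [/\ continuous g, g 0 = x & g 1 = y].
Proof.
split=> [[g cg [<- <-]]|[g [cg <- <-]]]; last first.
  by exists g => //; exact: continuous_subspaceT.
exists (g \o @clip01 R); split; last 2 first.
- by rewrite /= clip01_id // lexx ler01.
- by rewrite /= clip01_id // lexx ler01.
apply: continuous_within_comp cg (@clip01_continuous R) _ => t /=.
by rewrite in_itv /= clip01_ge0 clip01_le1.
Qed.

Lemma joined_homotopic (X : topologicalType) (f g : X -> T) x :
  homotopic R f g -> joined R (f x) (g x).
Proof.
move=> [H [cH H0 H1]]; apply/joinedP; exists (fun t => H (t, x)); split => //.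
apply: (continuous_comp_fun cH); apply: continuous_pair.
  by move=> t; exact: cvg_id.
exact: continuous_const.
Qed.

Lemma joined_sym (x y : T) : joined R x y -> joined R y x.
Proof.
move=> /joinedP[g [cg g0 g1]]; apply/joinedP.
exists (fun t => g (1 - t)); split; rewrite ?subr0 ?subrr //.
apply: (continuous_comp_fun cg); apply: continuous_addr.
  exact: continuous_const.
by apply: continuous_oppr => t; exact: cvg_id.
Qed.

Lemma joined_trans (x y z : T) : joined R x y -> joined R y z -> joined R x z.
Proof.
move=> /joinedP[g [cg g0 g1]] /joinedP[h [ch h0 h1]]; apply/joinedP.
have cid : continuous (fun t : R => t) by move=> t; exact: cvg_id.
exists (fun t => if t <= 2^-1 then g (2 * t) else h (2 * t - 1)); split.
- have c2 : continuous (fun t : R => 2 * t).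
    by apply: continuous_mulr => //; exact: continuous_const.
  apply: continuous_glue => //.
  + exact: (continuous_comp_fun cg).
  + apply: (continuous_comp_fun ch); apply: continuous_addr => //.
    exact: continuous_const.
  + by move=> t ->; rewrite divff ?pnatr_eq0 // subrr g1 h0.
- by rewrite invr_ge0 ler0n mulr0.
- by rewrite ifF; [rewrite -h1; congr h; lra|lra].
Qed.

End Paths.

Lemma joined_image (R : realType) (X Y : topologicalType) (f : X -> Y) x y :
  continuous f -> joined R x y -> joined R (f x) (f y).
Proof.
move=> cf /joinedP[g [cg <- <-]]; apply/joinedP.
by exists (f \o g); split => //; exact: continuous_comp_fun.
Qed.

(** * Homotopy groups under free homotopies *)

Section Cubes.
Variables (R : realType) (n : nat).
Implicit Types (s : 'rV[R]_n.+1) (m : R).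

(** This is the sup norm after the change of coordinates taking the cube to the product of intervals
    [-1, 1]: the cube is its unit ball, the boundary its unit sphere. In these coordinates
    [cube_scale m] divides by m, and [cube_retract] is the radial retraction. *)
Definition cube_norm s : R := `|2 *: s - const_mx 1|.

Definition cube_scale m s : 'rV[R]_n.+1 :=
  2^-1 *: (const_mx 1 + m^-1 *: (2 *: s - const_mx 1)).

Definition cube_retract s := cube_scale (Num.max 1 (cube_norm s)) s.

Lemma cube_norm_ge0 s : 0 <= cube_norm s.
Proof. exact: normr_ge0. Qed.

Lemma cube_norm_scale m s : 0 < m -> cube_norm (cube_scale m s) = cube_norm s / m.
Proof.
move=> m0; rewrite /cube_norm /cube_scale scalerA divff ?pnatr_eq0 // scale1r.
by rewrite addrAC subrr add0r normrZ gtr0_norm ?invr_gt0 // mulrC.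
Qed.

Lemma cube_scale1 s : cube_scale 1 s = s.
Proof.
rewrite /cube_scale invr1 scale1r addrCA subrr addr0 scalerA mulVf ?scale1r //.
by rewrite pnatr_eq0.
Qed.

Lemma cube_normP s : cube s <-> cube_norm s <= 1.
Proof.
rewrite /cube_norm; split=> [cs|s1 i].
  rewrite [leLHS]/Num.norm /= mx_normrE; apply/bigmax_leP; split=> // -[i j] _ /=.
  by rewrite !mxE (ord1 i) ler_norml; have := cs j; lra.
have : `|(2 *: s - const_mx 1) 0 i| <= 1.
  apply: le_trans s1; rewrite [leRHS]/Num.norm /= mx_normrE.
  by apply/bigmax_geP; right; exists (0, i).
by rewrite !mxE ler_norml; lra.
Qed.

Lemma cube_boundaryP s : cube_boundary s <-> cube_norm s = 1.
Proof.
split=> [[/cube_normP cs [i si]]|s1].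
  apply/le_anti; rewrite cs /=.
  have -> : 1 = `|(2 *: s - const_mx 1) 0 i|.
    rewrite !mxE; case: si => ->; first by rewrite mulr0 sub0r normrN1.
    by rewrite mulr1 ger0_norm; lra.
  rewrite /cube_norm [leRHS]/Num.norm /= mx_normrE.
  by apply/bigmax_geP; right; exists (0, i).
split; first by apply/cube_normP; rewrite s1.
(* A nonzero sup norm is attained at some entry, and that coordinate lies on a face. *)
have : mx_norm (2 *: s - const_mx 1) != 0.
  by rewrite -[mx_norm _]/(cube_norm s) s1 oner_eq0.
move=> /mx_norm_neq0[[i j]] /=; rewrite (ord1 i).
rewrite -[LHS]/(cube_norm s) s1 !mxE => /esym/eqP.
by rewrite eqr_norml => /andP[/orP[]/eqP sj _]; exists j; [right|left]; lra.
Qed.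

Lemma cube_boundary_cube s : cube_boundary s -> cube s.
Proof. by case. Qed.

Lemma cube_scale_cube m s : 0 < m -> cube_norm s <= m -> cube (cube_scale m s).
Proof.
by move=> m0 sm; apply/cube_normP; rewrite cube_norm_scale // ler_pdivrMr ?mul1r.
Qed.

Lemma cube_retract_cube s : cube (cube_retract s).
Proof.
by apply: cube_scale_cube; rewrite ?lt_max ?ltr01 // le_max lexx orbT.
Qed.

Lemma cube_retract_id s : cube s -> cube_retract s = s.
Proof. by move/cube_normP => s1; rewrite /cube_retract (max_idPl s1) cube_scale1. Qed.

Section Continuity.
Variables (T : topologicalType) (f : T -> R) (g : T -> 'rV[R]_n.+1).
Hypothesis cg : continuous g.

Lemma continuous_cube_norm : continuous (fun t => cube_norm (g t)).
Proof.
apply: continuous_norm; apply: continuous_addr; last exact: continuous_const.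
by apply: continuous_scaler cg; exact: continuous_const.
Qed.

Lemma continuous_cube_scale : (forall t, f t != 0) -> continuous f ->
  continuous (fun t => cube_scale (f t) (g t)).
Proof.
move=> f0 cf; apply: continuous_scaler; first exact: continuous_const.
apply: continuous_addr; first exact: continuous_const.
apply: continuous_scaler; first exact: continuous_invr.
apply: continuous_addr; last exact: continuous_const.
by apply: continuous_scaler cg; exact: continuous_const.
Qed.

End Continuity.

Lemma cube_retract_continuous : continuous cube_retract.
Proof.
have cid : continuous (fun s : 'rV[R]_n.+1 => s) by move=> s; exact: cvg_id.
apply: continuous_cube_scale => // [s|]; first by rewrite gt_eqF ?lt_max ?ltr01.
apply: continuous_maxr; first exact: continuous_const.
exact: continuous_cube_norm.
Qed.

End Cubes.

Section CubeHomotopy.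
Variables (R : realType) (n : nat).

(** Composing with [clip01] in time and [cube_retract] in space turns a map continuous within the
    cylinder into a globally continuous one with the same values there. *)
Lemma cube_homotopicP (T : topologicalType) (x : T) (a b : 'rV[R]_n.+1 -> T) :
  cube_homotopic x a b <-> exists h : R * 'rV[R]_n.+1 -> T,
    [/\ continuous h, forall s, cube s -> h (0, s) = a s,
        forall s, cube s -> h (1, s) = b s &
        forall (t : R) s, 0 <= t <= 1 -> cube_boundary s -> h (t, s) = x].
Proof.
split=> -[h [ch h0 h1 hx]].
- exists (fun p => h (clip01 p.1, cube_retract p.2)); split.
  + apply: (@continuous_within_comp _ _ _ _ h
      (fun p : R * 'rV[R]_n.+1 => (clip01 p.1, cube_retract p.2)) ch).
      apply: continuous_pair.
        by apply: (continuous_comp_fun (@clip01_continuous R)) => p; exact: cvg_fst.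
      by apply: (continuous_comp_fun (@cube_retract_continuous R n)) => p;
        exact: cvg_snd.
    move=> p; split => /=; last exact: cube_retract_cube.
    by rewrite in_itv /= clip01_ge0 clip01_le1.
  + by move=> s cs; rewrite /= clip01_id ?lexx ?ler01 // cube_retract_id // h0.
  + by move=> s cs; rewrite /= clip01_id ?lexx ?ler01 // cube_retract_id // h1.
  + move=> t s t01 bs /=; rewrite clip01_id // cube_retract_id ?hx //.
    exact: cube_boundary_cube.
- by exists h; split => //; exact: continuous_subspaceT.
Qed.

Lemma based_cubeP (T : topologicalType) (x : T) (a : 'rV[R]_n.+1 -> T) :
  based_cube x a -> exists a' : 'rV[R]_n.+1 -> T,
    [/\ continuous a', forall s, cube s -> a' s = a s &
        forall s, cube_boundary s -> a' s = x].
Proof.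
move=> [ca ax]; exists (a \o @cube_retract R n); split.
- apply: continuous_within_comp ca (@cube_retract_continuous R n) _.
  exact: cube_retract_cube.
- by move=> s cs; rewrite /= cube_retract_id.
- by move=> s bs; rewrite /= cube_retract_id ?ax //; exact: cube_boundary_cube.
Qed.

Lemma cube_homotopic_eq (T : topologicalType) (x : T)
    (a b a' b' : 'rV[R]_n.+1 -> T) :
  (forall s, cube s -> a s = a' s) -> (forall s, cube s -> b s = b' s) ->
  cube_homotopic x a b -> cube_homotopic x a' b'.
Proof.
move=> aa' bb' [h [ch h0 h1 hx]].
by exists h; split => // s cs; rewrite ?h0 ?h1 ?aa' ?bb'.
Qed.

Lemma cube_homotopic_sym (T : topologicalType) (x : T) (a b : 'rV[R]_n.+1 -> T) :
  cube_homotopic x a b -> cube_homotopic x b a.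
Proof.
move=> /cube_homotopicP[h [ch h0 h1 hx]]; apply/cube_homotopicP.
exists (fun p => h (1 - p.1, p.2)); split.
- apply: (continuous_comp_fun ch); apply: continuous_pair; last first.
    by move=> p; exact: cvg_snd.
  apply: continuous_addr; first exact: continuous_const.
  by apply: continuous_oppr => p; exact: cvg_fst.
- by move=> s cs /=; rewrite subr0 h1.
- by move=> s cs /=; rewrite subrr h0.
- by move=> t s t01 bs /=; rewrite hx //; lra.
Qed.

Lemma cube_homotopic_trans (T : topologicalType) (x : T)
    (a b c : 'rV[R]_n.+1 -> T) :
  cube_homotopic x a b -> cube_homotopic x b c -> cube_homotopic x a c.
Proof.
move=> /cube_homotopicP[h [ch h0 h1 hx]] /cube_homotopicP[k [ck k0 k1 kx]].
(* The two homotopies agree at the junction over the cube only; after the retraction they agree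
   everywhere and can be pasted. *)
pose r (p : R * 'rV[R]_n.+1) := (p.1, cube_retract p.2).
have cr : continuous r.
  apply: continuous_pair; first by move=> p; exact: cvg_fst.
  by apply: (continuous_comp_fun (@cube_retract_continuous R n)) => p;
    exact: cvg_snd.
have hk s : (h \o r) (1, s) = (k \o r) (0, s).
  by rewrite /= h1 ?k0 //; exact: cube_retract_cube.
apply/cube_homotopicP; exists (fun p : R * 'rV[R]_n.+1 =>
  if p.1 <= 2^-1 then (h \o r) (2 * p.1, p.2) else (k \o r) (2 * p.1 - 1, p.2)).
split.
- by apply: continuous_concat => //; exact: continuous_comp_fun.
- by move=> s cs; rewrite /= /r /= invr_ge0 ler0n /= mulr0 cube_retract_id // h0.
- move=> s cs; rewrite /= /r /= ifF; last by lra.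
  by rewrite cube_retract_id // -k1 //; congr (k (_, _)); lra.
- move=> t s t01 bs; have cs := cube_boundary_cube bs.
  rewrite /= /r /= cube_retract_id //; case: ifPn => t2.
    by rewrite hx //; lra.
  by rewrite kx //; lra.
Qed.

(* A is pushed into a collar of the boundary, where it only depends on its
   trace g; what remains in the middle is A at time 0. *)
Lemma free_homotopy_end (T : topologicalType) (g : R -> T)
    (A B : R * 'rV[R]_n.+1 -> T) :
  continuous A -> continuous B ->
  (forall (t : R) s, 0 <= t <= 1 -> cube_boundary s -> A (t, s) = g t) ->
  (forall (t : R) s, 0 <= t <= 1 -> cube_boundary s -> B (t, s) = g t) ->
  (forall s, cube s -> A (0, s) = B (0, s)) ->
  cube_homotopic (g 1) (fun s => A (1, s)) (fun s => B (1, s)).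
Proof.
(* At t = 1, [k] stretches the inner ball of norm at most 1/2 over the whole cube at time 0, and
   sends a point s of the outer collar to the boundary point on its ray at time
   [2 * cube_norm s - 1]. The lower bound 1/2 in [m] keeps the divisor positive for every real t. *)
pose m (p : R * 'rV[R]_n.+1) := Num.max (2^-1) (Num.max (cube_norm p.2) (1 - p.1 / 2)).
pose k (p : R * 'rV[R]_n.+1) : R * 'rV[R]_n.+1 :=
  (Num.max (1 - p.1) (2 * cube_norm p.2 - 1), cube_scale (m p) p.2).
have m0 p : 0 < m p by rewrite lt_max invr_gt0 ltr0n.
have c1 : continuous (fun p : R * 'rV[R]_n.+1 => p.1) by move=> p; exact: cvg_fst.
have c2 : continuous (fun p : R * 'rV[R]_n.+1 => p.2) by move=> p; exact: cvg_snd.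
have cc c : continuous (fun p : R * 'rV[R]_n.+1 => c : R) by exact: continuous_const.
have cn := continuous_cube_norm c2.
have cm : continuous m.
  apply: continuous_maxr => //; apply: continuous_maxr => //.
  apply: continuous_addr => //; apply: continuous_oppr.
  exact: continuous_mulr.
have ck : continuous k.
  apply: continuous_pair.
    apply: continuous_maxr.
      by apply: continuous_addr => //; exact: continuous_oppr.
    by apply: continuous_addr => //; exact: continuous_mulr.
  by apply: continuous_cube_scale => // p; rewrite gt_eqF.
have k0 s : cube s -> k (0, s) = (1, s).
  move=> /cube_normP s1; have s0 := cube_norm_ge0 s; congr (_, _) => /=.
    by rewrite subr0 (max_idPl _) //; lra.
  rewrite /m /= mul0r subr0 (max_idPr s1) (max_idPr _) ?cube_scale1 //.
  lra.
have push (C : R * 'rV[R]_n.+1 -> T) : continuous C ->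
    (forall (t : R) s, 0 <= t <= 1 -> cube_boundary s -> C (t, s) = g t) ->
    cube_homotopic (g 1) (fun s => C (1, s)) (fun s => C (k (1, s))).
  move=> cC Cg; apply/cube_homotopicP; exists (C \o k); split => //.
  - exact: continuous_comp_fun.
  - by move=> s cs /=; rewrite k0.
  - move=> t s t01 bs; have /cube_boundaryP s1 := bs; rewrite /= /k /m /= s1.
    have -> : Num.max (1 - t) (2 * 1 - 1) = 1 :> R by rewrite (max_idPr _); lra.
    have -> : Num.max 1 (1 - t / 2) = 1 :> R by rewrite (max_idPl _) //; lra.
    rewrite (max_idPr _); last by lra.
    by rewrite cube_scale1 Cg //; lra.
move=> cA cB Ag Bg AB.
apply: cube_homotopic_trans (push _ cA Ag) _.
apply: cube_homotopic_sym; apply: cube_homotopic_eq (push _ cB Bg) => // s.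
move=> /cube_normP s1; have s0 := cube_norm_ge0 s; rewrite /k /m /= subrr.
have [s2|s2] := leP (cube_norm s) 2^-1.
  have -> : Num.max 0 (2 * cube_norm s - 1) = 0 by rewrite (max_idPl _) //; lra.
  rewrite AB //; apply: cube_scale_cube; last by rewrite le_max s2.
  by rewrite lt_max invr_gt0 ltr0n.
have -> : Num.max 0 (2 * cube_norm s - 1) = 2 * cube_norm s - 1.
  by rewrite (max_idPr _) //; lra.
have -> : Num.max (cube_norm s) (1 - 1 / 2) = cube_norm s.
  by rewrite (max_idPl _) //; lra.
rewrite (max_idPr (ltW s2)).
have bs : cube_boundary (cube_scale (cube_norm s) s).
  by apply/cube_boundaryP; rewrite cube_norm_scale ?divff //; lra.
by rewrite Ag ?Bg //; lra.
Qed.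

End CubeHomotopy.

(** * Homotopy equivalences are weak homotopy equivalences *)

Section HomotopyEquivalence.
Variable R : realType.

Lemma cube_homotopic_image n (X Y : topologicalType) (f : X -> Y) (x : X)
    (a b : 'rV[R]_n.+1 -> X) :
  continuous f -> cube_homotopic x a b ->
  cube_homotopic (f x) (f \o a) (f \o b).
Proof.
move=> cf /cube_homotopicP[h [ch h0 h1 hx]]; apply/cube_homotopicP.
exists (f \o h); split.
- exact: continuous_comp_fun.
- by move=> s cs; rewrite /= h0.
- by move=> s cs; rewrite /= h1.
- by move=> t s t01 bs; rewrite /= hx.
Qed.

Lemma based_cube_image n (X Y : topologicalType) (f : X -> Y) (x : X)
    (a : 'rV[R]_n.+1 -> X) :
  continuous f -> based_cube x a -> based_cube (f x) (f \o a).
Proof.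
move=> cf /based_cubeP[a' [ca aa' ax]]; split; last first.
  by move=> s bs /=; rewrite -aa' ?ax //; exact: cube_boundary_cube.
apply: (@continuous_within_eq _ _ _ (f \o a')).
  by move=> s cs; rewrite /= aa'.
exact: continuous_comp_fun.
Qed.

Section FreeHomotopyToIdentity.
Variables (n : nat) (X : topologicalType) (phi : X -> X) (H : R * X -> X).
Hypotheses (cH : continuous H) (H0 : forall x, H (0, x) = phi x)
  (H1 : forall x, H (1, x) = x).
Let S := 'rV[R]_n.+1.

Let continuous_slice t (f : S -> X) : continuous f ->
  continuous (fun s => H (t, f s)).
Proof.
move=> cf; apply: (continuous_comp_fun cH); apply: continuous_pair => //.
exact: continuous_const.
Qed.

Let continuous_track (f : S -> X) : continuous f ->
  continuous (fun p : R * S => H (p.1, f p.2)).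
Proof.
move=> cf; apply: (continuous_comp_fun cH); apply: continuous_pair.
  by move=> p; exact: cvg_fst.
by apply: (continuous_comp_fun cf) => p; exact: cvg_snd.
Qed.

(** Injectivity of [phi] on homotopy groups. [A] rests at [phi \o a] and then follows H to a; [B]
    runs through N from [phi \o a] to [phi \o b] and then follows H to b. They have the same start
    and the same trace [g], so [free_homotopy_end] applies. *)
Lemma cube_homotopic_cancel (x : X) (a b : S -> X) :
  based_cube x a -> based_cube x b ->
  cube_homotopic (phi x) (phi \o a) (phi \o b) -> cube_homotopic x a b.
Proof.
move=> /based_cubeP[a' [ca aa' ax]] /based_cubeP[b' [cb bb' bx]].
move=> /cube_homotopicP[N [cN N0 N1 Nx]].
pose r := @cube_retract R n.
have cr : continuous r := @cube_retract_continuous R n.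
have c1 : continuous (fun p : R * S => p.1) by move=> p; exact: cvg_fst.
have c2 : continuous (fun p : R * S => p.2) by move=> p; exact: cvg_snd.
pose g t := if t <= 2^-1 then phi x else H (2 * t - 1, x).
pose A (p : R * S) :=
  if p.1 <= 2^-1 then H (0, a' p.2) else H (2 * p.1 - 1, a' p.2).
pose B (p : R * S) :=
  if p.1 <= 2^-1 then N (2 * p.1, r p.2) else H (2 * p.1 - 1, b' (r p.2)).
have end1 (T : Type) (u v : T) : (if (1 : R) <= 2^-1 then u else v) = v.
  by rewrite ifF //; lra.
have two1 : 2 * 1 - 1 = 1 :> R by lra.
have := @free_homotopy_end R n X g A B.
rewrite /A /B /g /= !end1 two1 H1.
move=> FH; apply: cube_homotopic_eq (FH _ _ _ _ _).
- by move=> s cs; rewrite end1 ?two1 H1 aa'.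
- by move=> s cs; rewrite end1 ?two1 H1 /r cube_retract_id // bb'.
- apply: (@continuous_concat R _ _ (fun p => H (0, a' p.2))
    (fun p => H (p.1, a' p.2))) => //.
    by apply: (continuous_comp_fun (continuous_slice ca)).
  exact: continuous_track.
- apply: (@continuous_concat R _ _ (fun p => N (p.1, r p.2))
    (fun p => H (p.1, b' (r p.2)))) => [||s].
  + apply: (continuous_comp_fun cN); apply: continuous_pair => //.
    exact: continuous_comp_fun.
  + by apply: (continuous_track (f := b' \o r)); exact: continuous_comp_fun.
  + have rs := cube_retract_cube s.
    by rewrite /= N1 //= H0 -bb'.
- by move=> t s t01 bs; rewrite ax // H0.
- move=> t s t01 bs; rewrite /r cube_retract_id; last exact: cube_boundary_cube.
  by case: ifPn => t2; rewrite ?Nx ?bx //; lra.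
- move=> s cs; rewrite invr_ge0 ler0n mulr0 /r cube_retract_id // N0 //= H0.
  by rewrite aa'.
Qed.

(** Surjectivity of [phi] on homotopy groups. [E] extends c beyond the cube by the path [H (-, x)]
    from [phi x] to x, and [a] reads [E] on the concentric cube of twice the size. From [a], one
    homotopy runs H backwards to [phi \o a], the other shrinks the collar until c is left; their
    traces on the boundary coincide. *)
Lemma cube_homotopic_lift (x : X) (c : S -> X) :
  based_cube (phi x) c ->
  exists2 a, based_cube x a & cube_homotopic (phi x) (phi \o a) c.
Proof.
move=> /based_cubeP[c' [cc cc' cx]].
have c2 : continuous (fun p : R * S => p.2) by move=> p; exact: cvg_snd.
have cid : continuous (fun s : S => s) by move=> p; exact: cvg_id.
pose E (q : S) := if cube_norm q <= 1 then c' q else H (cube_norm q - 1, x).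
have cE : continuous E.
  apply: continuous_glue => //.
  - exact: continuous_cube_norm.
  - apply: (continuous_comp_fun cH); apply: continuous_pair; last first.
      exact: continuous_const.
    apply: continuous_addr; last exact: continuous_const.
    exact: continuous_cube_norm.
  - by move=> q q1; rewrite q1 subrr H0 cx //; apply/cube_boundaryP.
have Eb s m : 1 <= m -> cube_boundary s ->
    E (cube_scale m^-1 s) = H (m - 1, x).
  move=> m1 /cube_boundaryP s1; rewrite /E cube_norm_scale ?invr_gt0; last lra.
  rewrite s1 invrK mul1r; case: ifPn => // m1'.
  have -> : m = 1 by lra.
  by rewrite subrr H0 invr1 cube_scale1 cx //; apply/cube_boundaryP.
pose a (s : S) := E (cube_scale 2^-1 s).
have ca : continuous a.
  apply: (continuous_comp_fun cE); apply: continuous_cube_scale => //.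
    by move=> s; rewrite invr_eq0 pnatr_eq0.
  exact: continuous_const.
have ax s : cube_boundary s -> a s = x.
  have two1 : 2 - 1 = 1 :> R by lra.
  by move=> bs; rewrite /a Eb ?two1 ?H1 //; lra.
exists a; first by split=> //; exact: continuous_subspaceT.
pose A (p : R * S) := H (1 - p.1, a p.2).
pose m (p : R * S) := 1 + clip01 (1 - p.1).
pose B (p : R * S) := E (cube_scale (m p)^-1 p.2).
have m1 p : 1 <= m p by rewrite lerDl clip01_ge0.
have := @free_homotopy_end R n X (fun t => H (1 - t, x)) A B.
rewrite /= subrr H0 => FH; apply: cube_homotopic_eq (FH _ _ _ _ _).
- by move=> s cs; rewrite /A /= subrr H0.
- move=> s cs; rewrite /B /m /= subrr clip01_id ?lexx ?ler01 // addr0 invr1.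
  by rewrite cube_scale1 /E ifT ?cc' //; apply/cube_normP.
- apply: (continuous_comp_fun cH); apply: continuous_pair; last first.
    exact: continuous_comp_fun.
  apply: continuous_addr; first exact: continuous_const.
  by apply: continuous_oppr => p; exact: cvg_fst.
- have m0 p : m p != 0 by have := m1 p; lra.
  apply: (continuous_comp_fun cE); apply: continuous_cube_scale => //.
    by move=> p; rewrite invr_eq0.
  apply: continuous_invr => //.
  apply: continuous_addr; first exact: continuous_const.
  apply: (continuous_comp_fun (@clip01_continuous R)).
  apply: continuous_addr; first exact: continuous_const.
  by apply: continuous_oppr => p; exact: cvg_fst.
- by move=> t s t01 bs; rewrite /A /= ax.
- move=> t s t01 bs; rewrite /B Eb // /m /= clip01_id; last by lra.
  by congr (H (_, _)); lra.
- move=> s cs; rewrite /A /B /m /= subr0 H1 clip01_id ?lexx ?ler01 //.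
Qed.

End FreeHomotopyToIdentity.

Lemma homotopy_equivalence_weak (X Y : topologicalType) (f : X -> Y)
    (g : Y -> X) :
  continuous f -> continuous g -> homotopic R (g \o f) id ->
  homotopic R (f \o g) id -> weak_homotopy_equivalence R f.
Proof.
move=> cf cg gf fg; have [H [cH H0 H1]] := gf; have [K [cK K0 K1]] := fg.
split => //.
- move=> x y fxy.
  apply: joined_trans (joined_homotopic y gf).
  apply: joined_trans (joined_sym (joined_homotopic x gf)) _.
  exact: (joined_image cg fxy).
- by move=> y; exists (g y); exact: (joined_homotopic y fg).
- move=> n x a b xa xb fab.
  apply: (cube_homotopic_cancel cH H0 H1 xa xb).
  exact: (cube_homotopic_image cg fab).
- move=> n x c fc.
  (* Lifting [g \o c] along [g \o f] gives an a for which [f \o a] and c become homotopic after g,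
     hence after [f \o g], which is injective by K. *)
  have [a xa gfa] := cube_homotopic_lift cH H0 H1 (based_cube_image cg fc).
  exists a => //.
  apply: (cube_homotopic_cancel cK K0 K1 _ fc).
    exact: based_cube_image.
  exact: (cube_homotopic_image cf gfa).
Qed.

End HomotopyEquivalence.

(** * Homotopies of realizations *)

Lemma continuous_row (R : realType) (T : topologicalType) (n : nat)
    (f : T -> 'rV[R]_n) :
  (forall j, continuous (fun t => f t 0 j)) -> continuous f.
Proof.
move=> cf t A [P Pt PA]; apply: filterS PA _.
apply: filter_forall => i; apply: filter_forall => j.
by rewrite (ord1 i); apply: cf; have := Pt 0 j.
Qed.

Lemma continuous_set_type (X T : topologicalType) (A : set X)
    (f : T -> set_type A) :
  continuous (fun t => \val (f t)) -> continuous f.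
Proof. by move=> cf; exact: (@continuous_comp_initial _ _ _ set_val). Qed.

Lemma continuous_val (X : topologicalType) (A : set X) :
  continuous (fun t : set_type A => \val t).
Proof. by move=> t; exact: initial_continuous. Qed.

(* The tube lemma over compact neighbourhoods in R makes the product of R with
   a quotient map a quotient map. *)
Lemma continuous_prod_quotient (R : realType) (I : choiceType)
    (X : I -> topologicalType) (Q : quotType {i & X i}) (Z : topologicalType)
    (h : R * quotient_topology Q -> Z) :
  (forall i, continuous (fun p : R * X i =>
     h (p.1, \pi_(quotient_topology Q) (existT X i p.2)))) ->
  continuous h.
Proof.
move=> ch [u0 y0] V; rewrite nbhsE => -[V' [oV' V'0] V'V].
rewrite nbhs_simpl /=; apply: filterS (preimage_subset V'V) _.
have [[i t] y0E] : exists e, y0 = \pi_(quotient_topology Q) e.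
  by exists (repr y0); rewrite reprK.
have : nbhs u0 [set u | V' (h (u, y0))].
  have ct : continuous (fun u : R => h (u, \pi_(quotient_topology Q) (existT X i t))).
    apply: (@continuous_comp_fun _ _ _ (fun u : R => (u, t)) _ (ch i)).
    apply: continuous_pair; last exact: continuous_const.
    by move=> u; exact: cvg_id.
  rewrite y0E; apply: (ct u0 V'); apply: open_nbhs_nbhs; split => //.
  by rewrite -y0E.
move=> /nbhs_ballP[d d0 Kd]; pose K : set R := [set u | u \in `[u0 - d / 2, u0 + d / 2]].
(* [K] is compact inside the ball on which the slice at [y0] stays in V'. Openness of [O] in the
   quotient is tested on each summand, where it is the tube lemma for [K]. *)
pose O : set (quotient_topology Q) := [set y | forall u, K u -> V' (h (u, y))].
have {i t y0E} Oy0 : O y0.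
  move=> u; rewrite /K /= in_itv /= => /andP[u1 u2]; apply: Kd => /=.
  by rewrite /ball /= ltr_norml; move: d0 => /=; lra.
have oO : open O.
  apply/sigT_openP => i; rewrite openE => t /= Ot.
  have : near_covering K by apply/compact_near_coveringP; exact: segment_compact.
  move=> /(_ _ (nbhs t) (fun t u => V' (h (u, \pi_(quotient_topology Q) (existT X i t))))).
  apply => u Ku.
  by apply: (ch i (u, t) V'); apply: open_nbhs_nbhs; split => //; exact: Ot.
exists (K, O) => /=.
  split; last exact: open_nbhs_nbhs.
  apply/nbhs_ballP; exists (d / 2); first by move: d0 => /=; lra.
  by move=> u; rewrite /ball /= /K /= in_itv /= ltr_norml; lra.
by move=> [u y] /= [Ku]; apply.
Qed.

(** * Monotone maps and weights on vertices *)

Lemma functor_mono m n (th : functor (ordcat m) (ordcat n)) (x y : 'I_m.+1) :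
  (x <= y)%N -> ((th x : 'I_n.+1) <= (th y : 'I_n.+1))%N.
Proof. by move=> xy; exact: (fmap th (xy : @hom (ordcat m) x y)). Qed.

(** The preimage of an initial segment under a monotone map is an initial segment. Hence the partial
    sums of a pushed-forward row occur among those of the original row. *)
Lemma functor_cut m n (th : functor (ordcat m) (ordcat n)) (i : nat) :
  exists2 k, (k <= m.+1)%N & forall x : 'I_m.+1, ((th x : 'I_n.+1) < i)%N = (x < k)%N.
Proof.
pose P k := [forall x : 'I_m.+1, (k <= x)%N ==> (i <= (th x : 'I_n.+1))%N].
have Pm : P m.+1 by apply/forallP => x; rewrite leqNgt ltn_ord.
case: (ex_minnP (ex_intro P _ Pm)) => k /forallP Pk kmin.
exists k => [|x]; first exact: kmin.
apply/idP/idP => [thi|xk].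
  by rewrite ltnNge; apply/negP => kx; move: (implyP (Pk x) kx); rewrite leqNgt thi.
rewrite ltnNge; apply/negP => ix; suff : (k <= x)%N by rewrite leqNgt xk.
apply: kmin; apply/forallP => y; apply/implyP => xy.
exact: leq_trans ix (functor_mono th xy).
Qed.

Section Rows.
Variable R : realType.

Lemma push_row_comp l m n (g : 'I_m.+1 -> 'I_n.+1) (f : 'I_l.+1 -> 'I_m.+1)
    (t : 'rV[R]_l.+1) :
  push_row g (push_row f t) = push_row (g \o f) t.
Proof.
apply/rowP => y; rewrite !mxE (partition_big f (fun x => g x == y)) //=.
by apply: eq_bigr => x /eqP <-; rewrite mxE; apply: eq_bigl => z;
  case: eqP => [->|]; rewrite ?eqxx ?andbF.
Qed.

Lemma push_rowD m n (f : 'I_m.+1 -> 'I_n.+1) (s t : 'rV[R]_m.+1) :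
  push_row f (s + t) = push_row f s + push_row f t.
Proof.
by apply/rowP => y; rewrite !mxE -big_split; apply: eq_bigr => x _; rewrite mxE.
Qed.

Lemma push_row0 m n (f : 'I_m.+1 -> 'I_n.+1) : push_row f (0 : 'rV[R]_m.+1) = 0.
Proof. by apply/rowP => y; rewrite !mxE big1 // => x _; rewrite mxE. Qed.

Lemma eq_push_row m n (f g : 'I_m.+1 -> 'I_n.+1) (t : 'rV[R]_m.+1) :
  (forall x, t 0 x != 0 -> f x = g x) -> push_row f t = push_row g t.
Proof.
move=> fg; apply/rowP => y; rewrite !mxE [LHS]big_mkcond [RHS]big_mkcond.
apply: eq_bigr => x _; have [->|/fg ->//] := eqVneq (t 0 x) 0.
by rewrite !if_same.
Qed.

Lemma push_row_sum m n (f : 'I_m.+1 -> 'I_n.+1) (t : 'rV[R]_m.+1) :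
  \sum_y push_row f t 0 y = \sum_x t 0 x.
Proof.
by rewrite (partition_big f xpredT) //=; apply: eq_bigr => y _; rewrite mxE.
Qed.

Lemma push_row_ge0 m n (f : 'I_m.+1 -> 'I_n.+1) (t : 'rV[R]_m.+1) :
  (forall x, 0 <= t 0 x) -> forall y, 0 <= push_row f t 0 y.
Proof. by move=> t0 y; rewrite mxE; exact: sumr_ge0. Qed.

Definition psum n (t : 'rV[R]_n.+1) (k : nat) : R :=
  \sum_(x < n.+1 | (x < k)%N) t 0 x.

Lemma psum0 n (t : 'rV[R]_n.+1) : psum t 0 = 0.
Proof. by rewrite /psum big_pred0. Qed.

Lemma psumS n (t : 'rV[R]_n.+1) (x : 'I_n.+1) : psum t x.+1 = psum t x + t 0 x.
Proof.
rewrite /psum (bigD1 x) //= addrC; congr (_ + _); apply: eq_bigl => y.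
by rewrite ltnS andbC ltn_neqAle.
Qed.

Lemma psum_all n (t : 'rV[R]_n.+1) : psum t n.+1 = \sum_x t 0 x.
Proof. by apply: eq_bigl => x; rewrite ltn_ord. Qed.

Lemma psum_le n (t : 'rV[R]_n.+1) k l : (forall x, 0 <= t 0 x) ->
  (k <= l)%N -> psum t k <= psum t l.
Proof.
move=> t0 kl; rewrite /psum [leRHS](bigID (fun x : 'I_n.+1 => (x < k)%N)) /=.
rewrite [X in _ <= X + _](eq_bigl (fun x : 'I_n.+1 => (x < k)%N)) => [|x].
  by rewrite lerDl; exact: sumr_ge0.
by case: (ltnP x k) => xk; rewrite ?andbF // andbT (leq_trans xk).
Qed.

Lemma psum_push m n (th : 'I_m.+1 -> 'I_n.+1) (t : 'rV[R]_m.+1) i k :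
  (forall x : 'I_m.+1, (th x < i)%N = (x < k)%N) ->
  psum (push_row th t) i = psum t k.
Proof.
move=> thk; rewrite /psum [RHS](partition_big th (fun y : 'I_n.+1 => (y < i)%N)).
  apply: eq_bigr => y yi; rewrite mxE; apply: eq_bigl => x.
  by rewrite -thk; case: eqP => [->|]; rewrite ?yi ?andbF.
by move=> x; rewrite thk.
Qed.

(* The increments of [phi] along the partial sums of t; with phi truncating at
   u from above or from below, this splits the weights t into the first u units
   of mass and the rest. *)
Definition warp (phi : R -> R) n (t : 'rV[R]_n.+1) : 'rV[R]_n.+1 :=
  \row_x (phi (psum t x.+1) - phi (psum t x)).

Lemma psum_warp phi n (t : 'rV[R]_n.+1) k : (k <= n.+1)%N ->
  psum (warp phi t) k = phi (psum t k) - phi 0.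
Proof.
elim: k => [|k IH] kn; first by rewrite !psum0 subrr.
rewrite -[k]/(val (Ordinal kn)) psumS /= IH ?(ltnW kn) // mxE /=.
by rewrite addrC addrA subrK.
Qed.

(** [warp] acts on partial sums, and those of a pushforward are partial sums of t. This makes the
    splitting of mass compatible with all faces and degeneracies. *)
Lemma warp_push phi m n (th : functor (ordcat m) (ordcat n)) (t : 'rV[R]_m.+1) :
  warp phi (push_row th t) = push_row th (warp phi t).
Proof.
apply/rowP => y; rewrite mxE.
have [k km thk] := functor_cut th y; have [l lm thl] := functor_cut th y.+1.
rewrite (psum_push t thk) (psum_push t thl).
have := psumS (push_row th (warp phi t)) y.
rewrite (psum_push _ thk) (psum_push _ thl) !psum_warp //.
by move=> ?; lra.
Qed.

End Rows.

(** * The interval and the vertex maps of the prism *)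

Definition boolcat : category.
Proof.
refine (@Category bool (fun a b => (a ==> b) : Prop)
  (fun a => implybb a) (fun a b c bc ab => introT implyP
    (fun ha => elimT implyP bc (elimT implyP ab ha))) _ _ _);
by move=> *; exact: bool_irrelevance.
Defined.

Lemma thin_functor_eq (C D : category) (F G : functor C D) :
  (forall (a b : D) (f g : hom a b), f = g) -> (forall x, F x = G x) -> F = G.
Proof.
move=> thin; case: F G => [F f f1 fM] [G g g1 gM] /= FG.
have {}FG : F = G by apply/funext.
subst G; have fg : f = g.
  do 3![apply: functional_extensionality_dep => ?]; exact: thin.
by subst g; congr Functor; exact: Prop_irrelevance.
Qed.

Lemma functor_ord_eq (C : category) n (F G : functor C (ordcat n)) :
  (forall x, val (F x : 'I_n.+1) = val (G x : 'I_n.+1)) -> F = G.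
Proof.
move=> FG; apply: thin_functor_eq => [a b f g|x]; first exact: bool_irrelevance.
by apply/val_inj/FG.
Qed.

Lemma functor_bool_eq (C : category) (F G : functor C boolcat) :
  (forall x, F x = G x) -> F = G.
Proof. by apply: thin_functor_eq => a b f g; exact: bool_irrelevance. Qed.

Definition mono_functor m n (f : 'I_m.+1 -> 'I_n.+1)
    (fm : forall x y : 'I_m.+1, (x <= y)%N -> (f x <= f y)%N) :
    functor (ordcat m) (ordcat n).
Proof.
by refine (@Functor (ordcat m) (ordcat n) f fm _ _) => *;
  exact: bool_irrelevance.
Defined.

(** Functors [ordcat n -> boolcat] are the n-simplices of the interval, [false] being the bottom and
    [true] the top of the prism. This one jumps right after the vertex j. *)
Definition step n (j : nat) : functor (ordcat n) boolcat.
Proof.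
unshelve refine (@Functor (ordcat n) boolcat
  (fun x : 'I_n.+1 => (j < x)%N) (fun x y xy => _) _ _).
- by apply/implyP => jx; exact: leq_trans jx xy.
- by move=> *; exact: bool_irrelevance.
- by move=> *; exact: bool_irrelevance.
Defined.

(** The degeneracy repeating the vertex j. The truncation at n takes effect only for j > n and makes
    the map defined for every natural number j. *)
Definition degen n (j : nat) : functor (ordcat n.+1) (ordcat n).
Proof.
refine (@mono_functor n.+1 n (fun x => inord (minn n (x - (j < x)))) _).
by move=> x y xy; rewrite !inordK; lia.
Defined.

Lemma degenE n (j : nat) (x : 'I_n.+2) : (j <= n)%N ->
  val (degen n j x : 'I_n.+1) = (x - (j < x))%N.
Proof. by move=> jn; rewrite /= inordK; have := ltn_ord x; lia. Qed.

(** For j <= n, the face map omitting the vertex [j.+1]. That vertex is (j,1) in the j-th simplex of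
    the prism and (j+1,0) in the next one, so this is the inclusion of their common facet. *)
Definition skip n (j : nat) : functor (ordcat n) (ordcat n.+1).
Proof.
refine (@mono_functor n n.+1 (fun x => inord (x + (j < x))) _).
by move=> x y xy; rewrite !inordK; have := ltn_ord x; have := ltn_ord y; lia.
Defined.

Lemma skipE n (j : nat) (x : 'I_n.+1) :
  val (skip n j x : 'I_n.+2) = (x + (j < x))%N.
Proof. by rewrite /= inordK; have := ltn_ord x; lia. Qed.

(* [m+1] is [m] with the vertex j doubled, [n+1] is [n] with th j doubled. *)
Definition prism_lift m n (th : functor (ordcat m) (ordcat n)) (j : nat) :
  functor (ordcat m.+1) (ordcat n.+1).
Proof.
refine (@mono_functor m.+1 n.+1
  (fun x => inord ((th (degen m j x) : 'I_n.+1) + (j < x))) _).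
move=> x y xy; have xy' := functor_mono th (functor_mono (degen m j) xy).
have xn := ltn_ord (th (degen m j x) : 'I_n.+1).
have yn := ltn_ord (th (degen m j y) : 'I_n.+1).
by rewrite !inordK; lia.
Defined.

Lemma prism_liftE m n (th : functor (ordcat m) (ordcat n)) (j : nat)
    (x : 'I_m.+2) :
  val (prism_lift th j x : 'I_n.+2) =
  ((th (degen m j x) : 'I_n.+1) + (j < x))%N.
Proof.
have xn := ltn_ord (th (degen m j x) : 'I_n.+1).
by apply: inordK; lia.
Qed.

Lemma prism_lift_lt m n (th : functor (ordcat m) (ordcat n)) (j : 'I_m.+1)
    (x : 'I_m.+2) :
  ((th j : 'I_n.+1) < (prism_lift th j x : 'I_n.+2))%N = (j < x)%N.
Proof.
rewrite [X in (_ < X)%N]prism_liftE.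
have d : val (degen m j x : 'I_m.+1) = (x - (j < x))%N by apply: degenE; rewrite -ltnS.
have [jx|xj] := ltnP j x.
  have := @functor_mono _ _ th j (degen m j x); rewrite /= in d *; lia.
have := @functor_mono _ _ th (degen m j x) j; rewrite /= in d *; lia.
Qed.

(** Together with [step_prism_lift]: the lift covers th on the base of the prism and the identity on
    the interval. *)
Lemma degen_prism_lift m n (th : functor (ordcat m) (ordcat n)) (j : 'I_m.+1) :
  comp_functor (degen n (th j : 'I_n.+1)) (prism_lift th j) =
  comp_functor th (degen m j).
Proof.
apply: functor_ord_eq => x.
rewrite [LHS]degenE; last by rewrite -ltnS ltn_ord.
by rewrite prism_lift_lt prism_liftE addnK.
Qed.

Lemma step_prism_lift m n (th : functor (ordcat m) (ordcat n)) (j : 'I_m.+1) :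
  comp_functor (step n.+1 (th j : 'I_n.+1)) (prism_lift th j) = step m.+1 j.
Proof. by apply: functor_bool_eq => x; exact: prism_lift_lt. Qed.

(** * Splitting the mass of a point over the prism *)

Section SplitRow.
Variable R : realType.
Implicit Type u : R.

(** The formula does not mention j: bottom mass of the vertex x goes to position x, top mass to
    position x+1. When j cuts at u, bottom mass sits at x <= j and top mass at x >= j, and these
    positions enumerate (0,0),..,(j,0),(j,1),..,(n,1). *)
Definition split_row u n (t : 'rV[R]_n.+1) : 'rV[R]_n.+2 :=
  push_row (widen_ord (leqnSn n.+1)) (warp (Num.min^~ u) t) +
  push_row (lift ord0) (warp (Num.max^~ u) t).

Lemma warp_minD_max u n (t : 'rV[R]_n.+1) :
  warp (Num.min^~ u) t + warp (Num.max^~ u) t = t.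
Proof.
apply/rowP => x; rewrite !mxE psumS; set p := psum t x.
have := addr_min_max p u; have := addr_min_max (p + t 0 x) u; lra.
Qed.

Lemma warp_ge0 (phi : R -> R) n (t : 'rV[R]_n.+1) :
  {homo phi : x y / x <= y} -> (forall x, 0 <= t 0 x) ->
  forall x, 0 <= warp phi t 0 x.
Proof.
move=> phi_le t0 x; rewrite mxE subr_ge0; apply: phi_le.
exact: psum_le (leqnSn x).
Qed.

Lemma split_row_simplex u n (t : std_simplex (R := R) (n := n)) :
  split_row u (val t) \in std_simplex (n := n.+1).
Proof.
apply/mem_set; have /set_mem[t0 t1] := valP t; split=> [x|].
  rewrite mxE; apply: addr_ge0; apply: push_row_ge0; apply: warp_ge0 => // y z yz.
    by rewrite le_min !ge_min yz lexx orbT.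
  by rewrite ge_max !le_max yz lexx orbT.
rewrite -t1 (eq_bigr _ (fun x _ => mxE _ _ _ _)) big_split /= !push_row_sum.
rewrite -big_split /= -[in RHS](warp_minD_max u (val t)).
by apply: eq_bigr => x _; rewrite [in RHS]mxE.
Qed.

Definition split_simplex u n (t : std_simplex (R := R) (n := n)) :
    std_simplex (R := R) (n := n.+1) :=
  exist _ (split_row u (val t)) (split_row_simplex u t).

(** Both inequalities are weak, so at a tie several j qualify. The price is an independence
    statement; the gain is a closed condition, on which continuity relies. *)
Definition cut_at u n (t : 'rV[R]_n.+1) (j : nat) :=
  psum t j <= u <= psum t j.+1.

Lemma cut_at_ex u n (t : std_simplex (R := R) (n := n)) :
  0 <= u <= 1 -> exists j : 'I_n.+1, cut_at u (val t) j.
Proof.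
have /set_mem[t0 t1] := valP t; move=> /andP[u0 u1].
have ex : exists j, u <= psum (val t) j.+1.
  by exists n; rewrite psum_all t1.
(* Minimality of j gives the lower bound on u, except at j = 0, where it is [0 <= u]. *)
case: (ex_minnP ex) => j ju jmin.
have jn : (j < n.+1)%N by rewrite ltnS; apply: jmin; rewrite psum_all t1.
exists (Ordinal jn); rewrite /cut_at /= ju andbT.
case: j ju jmin {jn} => [|j] ju jmin; first by rewrite psum0.
by rewrite leNgt; apply/negP => /ltW/jmin; rewrite ltnn.
Qed.

Section Cut.
Variables (u : R) (n : nat) (t : std_simplex (R := R) (n := n)).

Let psumW k l : (k <= l)%N -> psum (val t) k <= psum (val t) l.
Proof. by apply: psum_le; have /set_mem[] := valP t. Qed.

Lemma warp_min_eq0 k (x : 'I_n.+1) : u <= psum (val t) k -> (k <= x)%N ->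
  warp (Num.min^~ u) (val t) 0 x = 0.
Proof.
move=> uk kx; have ux := le_trans uk (psumW kx).
by rewrite mxE !(min_idPr _) ?subrr // (le_trans ux) ?psumW.
Qed.

Lemma warp_max_eq0 k (x : 'I_n.+1) : psum (val t) k <= u -> (x < k)%N ->
  warp (Num.max^~ u) (val t) 0 x = 0.
Proof.
move=> uk kx; have ux := le_trans (psumW kx) uk.
by rewrite mxE !(max_idPr _) ?subrr // (le_trans _ ux) ?psumW.
Qed.

(** If u is exactly the mass of the vertices up to j, no vertex is split and the point lies on the
    common facet of two neighbouring prism simplices. *)
Lemma split_row_skip j : psum (val t) j.+1 = u ->
  split_row u (val t) = push_row (skip n j) (val t).
Proof.
move=> ju; rewrite -[in RHS](warp_minD_max u (val t)) push_rowD.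
congr (_ + _); apply: eq_push_row => x nz; apply/val_inj;
  rewrite [RHS]skipE /=.
  case: (ltnP j x) => jx; last by rewrite addn0.
  by rewrite (@warp_min_eq0 j.+1) ?ju ?eqxx in nz.
rewrite /bump leq0n add1n; case: (ltnP j x) => jx; first by rewrite addn1.
by rewrite (@warp_max_eq0 j.+1) ?ju ?eqxx in nz.
Qed.

(** By [eq_push_row] only vertices carrying mass matter: at x <= j for the bottom and x >= j for the
    top, the lift is th on the respective copy. *)
Lemma split_row_prism_lift m (th : functor (ordcat n) (ordcat m)) (j : 'I_n.+1) :
  cut_at u (val t) j ->
  push_row (prism_lift th j) (split_row u (val t)) =
  split_row u (push_row th (val t)).
Proof.
move=> /andP[ju uj]; rewrite push_rowD !push_row_comp /split_row !warp_push.
rewrite !push_row_comp; congr (_ + _); apply: eq_push_row => x nz;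
  apply/val_inj; rewrite [LHS]prism_liftE /=.
  have xj : (x <= j)%N.
    by rewrite leqNgt; apply: contra nz => jx; rewrite (@warp_min_eq0 j.+1).
  rewrite ltnNge xj addn0; congr (val (th _ : 'I_m.+1)); apply/val_inj.
  by rewrite /= inordK; have := ltn_ord x; lia.
have jx : (j <= x)%N.
  by rewrite leqNgt; apply: contra nz => xj; rewrite (@warp_max_eq0 j).
rewrite /bump leq0n /= add1n ltnS jx addn1 add1n.
congr (val (th _ : 'I_m.+1)).+1; apply/val_inj.
by rewrite /= inordK /bump; have := ltn_ord x; lia.
Qed.

Lemma cut_at_push m (th : functor (ordcat n) (ordcat m)) (j : 'I_n.+1) :
  cut_at u (val t) j -> cut_at u (push_row th (val t)) (th j : 'I_m.+1).
Proof.
move=> /andP[ju uj]; rewrite /cut_at.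
have [k km thk] := functor_cut th (th j : 'I_m.+1).
have [l lm thl] := functor_cut th (th j : 'I_m.+1).+1.
rewrite (psum_push _ thk) (psum_push _ thl); apply/andP; split.
  apply: le_trans ju; apply: psumW; rewrite leqNgt; apply/negP => jk.
  by have := thk j; rewrite jk ltnn.
apply: (le_trans uj); apply: psumW; by have := thl j; rewrite ltnSn => /esym.
Qed.

End Cut.
End SplitRow.

Lemma comp_id_functor (C D : category) (F : functor C D) :
  comp_functor (id_functor D) F = F.
Proof. by case: F => *; congr Functor; exact: Prop_irrelevance. Qed.

(** * Realizations of simplicial maps *)

Section RealizationMaps.
Variable R : realType.

Lemma realization_continuous (X : sset) (Z : topologicalType)
    (f : realization R X -> Z) :
  (forall n (s : X n), continuous (fun t => f (\pi_(realization R X) (cell s t)))) ->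
  continuous f.
Proof.
move=> cf; apply/quotient_continuous.
move=> [[n s] t]; exact: (cf n s t).
Qed.

Lemma pi_cell_continuous (X : sset) n (s : X n) :
  continuous (fun t => \pi_(realization R X) (cell s t)).
Proof.
apply: (@continuous_comp_fun _ _ _ (fun t => cell s t)); first exact: pi_continuous.
by move=> t; exact: existT_continuous.
Qed.

Lemma realization_map_cell (X Y : sset) (f : smap X Y) n (s : X n) t :
  realization_map f (\pi_(realization R X) (cell s t)) =
  \pi_(realization R Y) (cell (f n s) t).
Proof. exact: realization_mapE. Qed.

Lemma realization_cell (X : sset) (y : realization R X) :
  exists n (s : X n) t, y = \pi_(realization R X) (cell s t).
Proof.
by rewrite -[y]reprK; case: (repr y) => -[n s] t; exists n, s, t.
Qed.

Lemma realization_map_continuous (X Y : sset) (f : smap X Y) :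
  continuous (@realization_map R _ _ f).
Proof.
apply: realization_continuous => n s.
have -> : (fun t => realization_map f (\pi_(realization R X) (cell s t))) =
    (fun t => \pi_(realization R Y) (cell (f n s) t)).
  by apply/funext => t; exact: realization_map_cell.
exact: pi_cell_continuous.
Qed.

Lemma realization_map_id (C : category) (y : realization R (nerve C)) :
  realization_map (nerve_map (id_functor C)) y = y.
Proof.
have [n [s [t ->]]] := realization_cell y; rewrite realization_map_cell /=.
by rewrite comp_id_functor.
Qed.

Lemma realization_map_comp (C D E : category) (G : functor D E) (F : functor C D)
    (y : realization R (nerve C)) :
  realization_map (nerve_map (comp_functor G F)) y =
  realization_map (nerve_map G) (realization_map (nerve_map F) y).
Proof.
have [n [s [t ->]]] := realization_cell y; rewrite !realization_map_cell /=.
by rewrite comp_functorA.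
Qed.

Lemma pi_glue (X : sset) m n (th : functor (ordcat m) (ordcat n)) (s : X n)
    (t : std_simplex (R := R) (n := m)) :
  \pi_(realization R X) (cell (sact th s) t) =
  \pi_(realization R X) (cell s (simplex_map th t)).
Proof. by apply/eqmodP/asboolP; apply: rst_step; exact: Glue. Qed.

End RealizationMaps.

(** * The homotopy of realizations defined by a simplicial homotopy *)

Section SimplicialHomotopy.
Variables (R : realType) (X Y : sset).
Variable h : forall n, X n -> functor (ordcat n) boolcat -> Y n.
Hypothesis h_nat : forall m n (th : functor (ordcat m) (ordcat n)) (s : X n) k,
  h (sact th s) (comp_functor k th) = sact th (h s k).

(** The pair of [sact (degen n j) s] and [step n.+1 j] is the j-th top-dimensional simplex of the
    prism over s, and h carries it to Y. The value is the intended one when j cuts t at u. *)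
Definition prism_point (u : R) n (s : X n) (t : std_simplex (R := R) (n := n))
    (j : nat) : realization R Y :=
  \pi_(realization R Y)
    (cell (h (sact (degen n j) s) (step n.+1 j)) (split_simplex u t)).

(** The split point lies on the facet [skip n j], along which the two neighbouring prism simplices
    restrict to the same simplex of X and of the interval. *)
Lemma prism_pointS u n (s : X n) (t : std_simplex (R := R) (n := n)) j :
  (j < n)%N -> psum (val t) j.+1 = u ->
  prism_point u s t j = prism_point u s t j.+1.
Proof.
move=> jn ju; rewrite /prism_point.
have -> : split_simplex u t = simplex_map (skip n j) t.
  by apply: val_inj => /=; exact: split_row_skip.
rewrite -!pi_glue -!h_nat -!sactM.
have skn x : ((skip n j x : 'I_n.+2) = x + (j < x) :> nat)%N by exact: skipE.
congr (\pi_(realization R Y) (cell (h (sact _ s) _) t)).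
  by apply: functor_ord_eq => x; rewrite !degenE ?skn //; lia.
apply: functor_bool_eq => x.
change (((j < (skip n j x : 'I_n.+2)) = (j.+1 < (skip n j x : 'I_n.+2)))%N).
by rewrite skn; lia.
Qed.

(** If i < j both cut at u, all partial sums from [i.+1] to j equal u, and [prism_pointS] leads from
    i to j one step at a time. *)
Lemma prism_point_cut u n (s : X n) (t : std_simplex (R := R) (n := n))
    (i j : 'I_n.+1) :
  cut_at u (val t) i -> cut_at u (val t) j ->
  prism_point u s t i = prism_point u s t j.
Proof.
wlog ij : i j / (i <= j)%N => [H ci cj|].
  by case/orP: (leq_total i j) => ij; [|symmetry]; exact: H.
have t0 x : 0 <= val t 0 x by have /set_mem[] := valP t.
move=> /andP[_ ui] /andP[ju _].
suff step_up d : (i + d <= j)%N -> prism_point u s t i = prism_point u s t (i + d)%N.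
  by rewrite (step_up (j - i)%N) subnKC.
elim: d => [|d IH] id; first by rewrite addn0.
rewrite IH; last by lia.
rewrite addnS; apply: prism_pointS; first by have := ltn_ord j; lia.
apply/le_anti; rewrite (le_trans _ ju) ?psum_le //=; last by lia.
by apply: (le_trans ui); apply: psum_le; rewrite // ltnS leq_addr.
Qed.

Lemma prism_point_glue u m n (th : functor (ordcat m) (ordcat n)) (s : X n)
    (t : std_simplex (R := R) (n := m)) (j : 'I_m.+1) :
  cut_at u (val t) j ->
  prism_point u (sact th s) t j =
  prism_point u s (simplex_map th t) (th j : 'I_n.+1).
Proof.
move=> cj; rewrite /prism_point.
have -> : split_simplex u (simplex_map th t) =
    simplex_map (prism_lift th j) (split_simplex u t).
  by apply: val_inj => /=; rewrite split_row_prism_lift.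
by rewrite -pi_glue -h_nat -!sactM degen_prism_lift step_prism_lift.
Qed.

Lemma prism_point_equiv u (e e' : cells R X) : 0 <= u <= 1 ->
  clos_refl_sym_trans (cells R X) (@glue R X) e e' ->
  forall (j : 'I_(projT1 (projT1 e)).+1) (j' : 'I_(projT1 (projT1 e')).+1),
  cut_at u (val (projT2 e)) j -> cut_at u (val (projT2 e')) j' ->
  prism_point u (projT2 (projT1 e)) (projT2 e) j =
  prism_point u (projT2 (projT1 e')) (projT2 e') j'.
Proof.
move=> u01; elim=> {e e'} [_ _ [m n th s t]|e|e e' _ IH|e1 e2 e3 _ IH1 _ IH2].
- move=> j j' /= cj cj'; rewrite prism_point_glue //.
  exact (@prism_point_cut u n s (simplex_map th t) _ j' (cut_at_push th cj) cj').
- case: e => -[n s] t j j' /= cj cj'; exact: prism_point_cut cj cj'.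
- by move=> j j' cj cj'; symmetry; exact: IH.
(* The intermediate cell comes without a cut; one exists because u lies in the unit interval. *)
- move=> j j' cj cj'; have [i ci] := cut_at_ex (projT2 e2) u01.
  by rewrite (IH1 _ _ cj ci) (IH2 _ _ ci cj').
Qed.

(** H is picked by choice, but its value is pinned down for every representing cell and every cut;
    clamping u makes it total. *)
Lemma prism_ex : exists H : R * realization R X -> realization R Y,
  forall u y n (s : X n) t (j : 'I_n.+1),
    y = \pi_(realization R X) (cell s t) ->
    cut_at (clip01 u) (val t) j -> H (u, y) = prism_point (clip01 u) s t j.
Proof.
suff /choice[H HP] : forall p : R * realization R X, exists z,
    forall n (s : X n) t (j : 'I_n.+1),
    p.2 = \pi_(realization R X) (cell s t) ->
    cut_at (clip01 p.1) (val t) j -> z = prism_point (clip01 p.1) s t j.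
  by exists H => u y n s t j yE; exact: (HP (u, y)).
move=> [u y] /=; have u01 : 0 <= clip01 u <= 1 by rewrite clip01_ge0 clip01_le1.
have [m [s0 [t0 yE]]] := realization_cell y.
have [j0 cj0] := cut_at_ex t0 u01.
exists (prism_point (clip01 u) s0 t0 j0) => n s t j yE' cj.
have /eqmodP/asboolP ee' : \pi_(realization R X) (cell s0 t0) =
  \pi_(realization R X) (cell s t) by rewrite -yE.
exact: (prism_point_equiv u01 ee').
Qed.

End SimplicialHomotopy.

Lemma continuous_sum (R : realType) (T : topologicalType) (I : Type) (r : seq I)
    (P : pred I) (f : I -> T -> R) :
  (forall i, continuous (f i)) -> continuous (fun t => \sum_(i <- r | P i) f i t).
Proof.
move=> cf; elim: r => [|i r IH].
  under eq_fun do rewrite big_nil; exact: continuous_const.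
under eq_fun do rewrite big_cons; case: (P i) => //.
exact: continuous_addr.
Qed.

Section RowContinuity.
Variables (R : realType) (T : topologicalType).

Lemma continuous_coord n (f : T -> 'rV[R]_n) x :
  continuous f -> continuous (fun p => f p 0 x).
Proof.
by move=> cf p; apply: (@cvg_comp _ _ _ f (fun M : 'rV[R]_n => M 0 x));
  [exact: cf|exact: coord_continuous].
Qed.

Variables (n : nat) (f : T -> 'rV[R]_n.+1) (u : T -> R).
Hypotheses (cf : continuous f) (cu : continuous u).

Lemma continuous_psum k : continuous (fun p => psum (f p) k).
Proof. by apply: continuous_sum => x; exact: continuous_coord. Qed.

Lemma continuous_split_row : continuous (fun p => split_row (u p) (f p)).
Proof.
apply: continuous_addr; apply: continuous_row => j;
  under eq_fun do rewrite mxE; apply: continuous_sum => x;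
  under eq_fun do rewrite mxE;
  apply: continuous_addr; try apply: continuous_oppr.
- by apply: continuous_minr => //; exact: continuous_psum.
- by apply: continuous_minr => //; exact: continuous_psum.
- by apply: continuous_maxr => //; exact: continuous_psum.
- by apply: continuous_maxr => //; exact: continuous_psum.
Qed.

Lemma closed_cut_at j : closed [set p | cut_at (u p) (f p) j].
Proof.
pose m p := Num.min (u p - psum (f p) j) (psum (f p) j.+1 - u p).
have -> : [set p | cut_at (u p) (f p) j] = m @^-1` [set x | 0 <= x].
  by apply/seteqP; split=> p; rewrite /cut_at /m /= le_min !subr_ge0.
have cm : continuous m.
  apply: continuous_minr; apply: continuous_addr => //;
    try apply: continuous_oppr => //; exact: continuous_psum.
exact: closed_comp (fun x _ => cm x) (@closed_ge R 0).
Qed.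

End RowContinuity.

Definition const_functor n (b : bool) : functor (ordcat n) boolcat.
Proof.
unshelve refine (@Functor (ordcat n) boolcat (fun=> b) (fun _ _ _ => _) _ _).
- exact: implybb.
- by move=> *; exact: bool_irrelevance.
- by move=> *; exact: bool_irrelevance.
Defined.

Section SimplicialHomotopyMap.
Variables (R : realType) (X Y : sset).
Variable h : forall n, X n -> functor (ordcat n) boolcat -> Y n.
Hypothesis h_nat : forall m n (th : functor (ordcat m) (ordcat n)) (s : X n) k,
  h (sact th s) (comp_functor k th) = sact th (h s k).

Lemma prism_point_continuous n (s : X n) j :
  continuous (fun p : R * std_simplex (R := R) (n := n) =>
    prism_point h (clip01 p.1) s p.2 j).
Proof.
apply: (@continuous_comp_fun _ _ _
  (fun p : R * std_simplex (R := R) (n := n) => split_simplex (clip01 p.1) p.2)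
  _ (@pi_cell_continuous R Y n.+1 (h (sact (degen n j) s) (step n.+1 j)))).
apply: continuous_set_type; apply: continuous_split_row.
  by apply: (continuous_comp_fun (@continuous_val _ _)) => p; exact: cvg_snd.
by apply: (continuous_comp_fun (@clip01_continuous R)) => p; exact: cvg_fst.
Qed.

Lemma prism_point0 n (s : X n) (t : std_simplex (R := R) (n := n)) :
  prism_point h 0 s t 0 = \pi_(realization R Y) (cell (h s (const_functor n true)) t).
Proof.
have fm (x y : 'I_n.+1) : (x <= y)%N -> (lift ord0 x <= lift ord0 y)%N.
  by rewrite /= /bump; lia.
rewrite /prism_point; have /set_mem[t0 t1] := valP t.
have -> : split_simplex 0 t = simplex_map (mono_functor fm) t.
  apply: val_inj; rewrite /= /split_row -[in RHS](warp_minD_max 0 (val t)).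
  rewrite push_rowD; congr (_ + _).
  have -> : warp (Num.min^~ 0) (val t) = 0.
    by apply/rowP => x; rewrite (@warp_min_eq0 _ _ _ _ 0) ?psum0 ?mxE.
  by rewrite !push_row0.
rewrite -pi_glue -h_nat -sactM.
have -> : comp_functor (degen n 0) (mono_functor fm) = id_functor _.
  apply: functor_ord_eq => x; rewrite degenE //= /bump; lia.
rewrite sact1; congr (\pi_(realization R Y) (cell (h s _) t)).
exact: functor_bool_eq.
Qed.

Lemma prism_point1 n (s : X n) (t : std_simplex (R := R) (n := n)) :
  prism_point h 1 s t n = \pi_(realization R Y) (cell (h s (const_functor n false)) t).
Proof.
have fm (x y : 'I_n.+1) : (x <= y)%N ->
  (widen_ord (leqnSn n.+1) x <= widen_ord (leqnSn n.+1) y)%N by [].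
rewrite /prism_point; have /set_mem[t0 t1] := valP t.
have -> : split_simplex 1 t = simplex_map (mono_functor fm) t.
  apply: val_inj; rewrite /= /split_row -[in RHS](warp_minD_max 1 (val t)).
  rewrite push_rowD; congr (_ + _).
  have -> : warp (Num.max^~ 1) (val t) = 0.
    by apply/rowP => x; rewrite (@warp_max_eq0 _ _ _ _ n.+1) ?psum_all ?t1 ?mxE.
  by rewrite !push_row0.
rewrite -pi_glue -h_nat -sactM.
have -> : comp_functor (degen n n) (mono_functor fm) = id_functor _.
  by apply: functor_ord_eq => x; rewrite degenE //=; have := ltn_ord x; lia.
rewrite sact1; congr (\pi_(realization R Y) (cell (h s _) t)).
by apply: functor_bool_eq => x /=; apply/negbTE; rewrite -leqNgt -ltnS.
Qed.

Lemma simplicial_homotopy (f g : smap X Y) :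
  (forall n (s : X n), h s (const_functor n false) = f n s) ->
  (forall n (s : X n), h s (const_functor n true) = g n s) ->
  homotopic R (@realization_map R _ _ f) (@realization_map R _ _ g).
Proof.
(* At u = 0 all mass is on top, where h restricts to g, so the constructed homotopy runs from g to
   f. *)
move=> hf hg; apply: homotopic_sym.
have [H HP] := prism_ex R h_nat.
have cH n (s : X n) : continuous (fun p : R * std_simplex (R := R) (n := n) =>
    H (p.1, \pi_(realization R X) (cell s p.2))).
  move=> [u0 t0] V HV.
  (* For each of the finitely many j, either j cuts at the base point, and continuity of its
     [prism_point] gives V' nearby, or the closed cut condition fails on a neighbourhood and V'
     holds there vacuously. At a nearby point any cutting j then computes H. *)
  pose V' (j : 'I_n.+1) := [set p : R * std_simplex (R := R) (n := n) |
    cut_at (clip01 p.1) (val p.2) j -> V (prism_point h (clip01 p.1) s p.2 j)].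
  have : \forall p \near (u0, t0), forall j, V' j p.
    apply: (@filter_forall _ _ V' (nbhs (u0, t0)) _) => j.
    have [cj|ncj] := boolP (cut_at (clip01 u0) (val t0) j).
      have Vj : nbhs (prism_point h (clip01 u0) s t0 j) V.
        by rewrite -(HP u0 _ n s t0 j erefl cj).
      have NV := @prism_point_continuous n s j (u0, t0) V Vj.
      by apply: (@filterS _ (nbhs (u0, t0)) _ _ _ _ NV) => p Vp _.
    have ccut : closed [set p : R * std_simplex (R := R) (n := n) |
        cut_at (clip01 p.1) (val p.2) j].
      apply: closed_cut_at.
        by apply: (continuous_comp_fun (@continuous_val _ _)) => p; exact: cvg_snd.
      by apply: (continuous_comp_fun (@clip01_continuous R)) => p; exact: cvg_fst.
    have oC : open_nbhs (u0, t0) (~` [set p : R * std_simplex (R := R) (n := n) |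
        cut_at (clip01 p.1) (val p.2) j]).
      by split; [exact: closed_openC|exact/negP].
    by apply: (@filterS _ (nbhs (u0, t0)) _ _ _ _ (open_nbhs_nbhs oC)) => p np /np.
  apply: filterS => -[u t] Vp /=.
  have u01 : 0 <= clip01 u <= 1 by rewrite clip01_ge0 clip01_le1.
  have [j cj] := cut_at_ex t u01.
  by rewrite (HP u _ n s t j erefl cj); exact: Vp.
exists H; split=> [|y|y].
- by apply: continuous_prod_quotient => -[n s]; exact: cH.
- have [n [s [t yE]]] := realization_cell y.
  have c0 : clip01 0 = 0 :> R by rewrite clip01_id // lexx ler01.
  rewrite (HP 0 y n s t ord0 yE) c0; first by rewrite prism_point0 hg yE realization_map_cell.
  have /set_mem[t0 t1] := valP t.
  by rewrite /cut_at psum0 lexx /=; apply: sumr_ge0.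
- have [n [s [t yE]]] := realization_cell y.
  have c1 : clip01 1 = 1 :> R by rewrite clip01_id // lexx ler01.
  rewrite (HP 1 y n s t ord_max yE) c1; first by rewrite prism_point1 hf yE realization_map_cell.
  have /set_mem[t0 t1] := valP t.
  by rewrite /cut_at psum_all t1 lexx andbT -t1 -psum_all psum_le.
Qed.

End SimplicialHomotopyMap.

(** * Natural transformations as homotopies *)

Record nat_trans (C D : category) (F G : functor C D) := NatTrans {
  ntr :> forall a, hom (F a) (G a);
  ntr_nat : forall a b (f : hom a b),
    ntr b \oc fmap F f = fmap G f \oc ntr a }.

Section NatTransHomotopy.
Variables (C D : category) (F G : functor C D) (alpha : nat_trans F G).

(** With [interp_map], the functor from the product of C and [boolcat] to D that alpha amounts to: F
    at [false], G at [true], and diagonals of naturality squares in between. [interp] composes it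
    with the pair of s and k. *)
Definition interp_ob (b : bool) (c : C) : D := if b then G c else F c.

Definition interp_map (b b' : bool) (c c' : C) (f : hom c c') :
    (b ==> b') -> hom (interp_ob b c) (interp_ob b' c') :=
  match b, b' return (b ==> b') -> hom (interp_ob b c) (interp_ob b' c') with
  | false, false => fun=> fmap F f
  | false, true => fun=> alpha c' \oc fmap F f
  | true, true => fun=> fmap G f
  | true, false => fun e => False_rect _ (notF e)
  end.

Lemma interp_map1 b c (e : b ==> b) : interp_map (idm c) e = idm _.
Proof. by case: b e => e; rewrite /= fmap1. Qed.

Lemma interp_mapM b b' b'' c c' c'' (g : hom c' c'') (f : hom c c')
    (e : b ==> b') (e' : b' ==> b'') (e'' : b ==> b'') :
  interp_map (g \oc f) e'' = interp_map g e' \oc interp_map f e.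
Proof.
case: b b' b'' e e' e'' => -[] [] //= e e' e''; rewrite !fmapM //.
- by rewrite !compmA ntr_nat.
- by rewrite compmA.
Qed.

Definition interp (A : category) (s : functor A C) (k : functor A boolcat) :
  functor A D.
Proof.
refine (@Functor A D (fun x => interp_ob (k x) (s x))
  (fun x y f => interp_map (fmap s f) (fmap k f : (k x : bool) ==> (k y : bool))) _ _).
- by move=> x; rewrite fmap1 interp_map1.
- by move=> x y z g f; rewrite fmapM; exact: interp_mapM.
Defined.

Lemma nat_trans_homotopic (R : realType) :
  homotopic R (@realization_map R _ _ (nerve_map F)) (@realization_map R _ _ (nerve_map G)).
Proof.
apply: (@simplicial_homotopy R (nerve C) (nerve D) (fun n s k => interp s k)).
- by move=> m n th s k; congr Functor; exact: Prop_irrelevance.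
- by move=> n s; congr Functor; exact: Prop_irrelevance.
- by move=> n s; congr Functor; exact: Prop_irrelevance.
Qed.

End NatTransHomotopy.

Lemma weak_equivalence_zigzag (R : realType) (C D : category) (F : functor C D)
    (G : functor D C) (T : functor D D) :
  nat_trans (id_functor C) (comp_functor G F) -> nat_trans (comp_functor F G) T ->
  nat_trans (id_functor D) T -> weak_equivalence R F.
Proof.
move=> a b c.
have real_id (E : category) :
    @realization_map R _ _ (nerve_map (id_functor E)) = id.
  by apply/funext => y; exact: realization_map_id.
have real_comp (A B E : category) (L : functor B E) (K : functor A B) :
    @realization_map R _ _ (nerve_map (comp_functor L K)) =
    @realization_map R _ _ (nerve_map L) \o @realization_map R _ _ (nerve_map K).
  by apply/funext => y; exact: realization_map_comp.
apply: (@homotopy_equivalence_weak R _ _ _ (@realization_map R _ _ (nerve_map G))).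
- exact: realization_map_continuous.
- exact: realization_map_continuous.
- by rewrite -real_comp -real_id; apply: homotopic_sym; exact: nat_trans_homotopic a R.
- rewrite -real_comp -real_id; apply: (homotopic_trans (nat_trans_homotopic b R)).
  by apply: homotopic_sym; exact: nat_trans_homotopic c R.
Qed.

(** * Zigzags *)

Section PushoutPullback.
Variable C : category.

(** Chosen mediating maps in Type, with uniqueness phrased as joint epimorphy of the legs: functors
    can be built from this data and their laws checked on the legs. *)
Record pushout (a b c : C) (u : hom a b) (f : hom a c) := Pushout {
  po_ob : C;
  po_l : hom b po_ob;
  po_r : hom c po_ob;
  po_comm : po_l \oc u = po_r \oc f;
  po_med : forall (e : C) (g : hom b e) (h : hom c e),
    g \oc u = h \oc f -> hom po_ob e;
  po_med_l : forall (e : C) (g : hom b e) (h : hom c e)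
    (gh : g \oc u = h \oc f), po_med gh \oc po_l = g;
  po_med_r : forall (e : C) (g : hom b e) (h : hom c e)
    (gh : g \oc u = h \oc f), po_med gh \oc po_r = h;
  po_inj : forall (e : C) (m m' : hom po_ob e),
    m \oc po_l = m' \oc po_l -> m \oc po_r = m' \oc po_r -> m = m' }.

Record pullback (b c d : C) (v : hom b d) (f : hom c d) := Pullback {
  pb_ob : C;
  pb_l : hom pb_ob b;
  pb_r : hom pb_ob c;
  pb_comm : v \oc pb_l = f \oc pb_r;
  pb_med : forall (e : C) (g : hom e b) (h : hom e c),
    v \oc g = f \oc h -> hom e pb_ob;
  pb_med_l : forall (e : C) (g : hom e b) (h : hom e c)
    (gh : v \oc g = f \oc h), pb_l \oc pb_med gh = g;
  pb_med_r : forall (e : C) (g : hom e b) (h : hom e c)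
    (gh : v \oc g = f \oc h), pb_r \oc pb_med gh = h;
  pb_inj : forall (e : C) (m m' : hom e pb_ob),
    pb_l \oc m = pb_l \oc m' -> pb_r \oc m = pb_r \oc m' -> m = m' }.

Lemma pushout_of_ex (a b c : C) (u : hom a b) (f : hom a c) :
  (exists d (f' : hom b d) (u' : hom c d),
     is_pushout_in (full_subcat C) u f f' u') -> pushout u f.
Proof.
move=> /cid[d /cid[f' /cid[u' [_ _ comm univ]]]].
have med e (g : hom b e) (h : hom c e) (gh : g \oc u = h \oc f) :=
  cid (univ e g h I I gh).
refine (@Pushout _ _ _ u f d f' u' comm
  (fun e g h gh => projT1 (med e g h gh)) _ _ _).
- by move=> e g h gh; case: (med e g h gh) => m [[]].
- by move=> e g h gh; case: (med e g h gh) => m [[]].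
- move=> e m m' ml mr.
  have gh : (m \oc f') \oc u = (m \oc u') \oc f by rewrite -!compmA comm.
  have [n [_ nuniq]] := univ e _ _ I I gh.
  by rewrite -(nuniq m) // -(nuniq m').
Qed.

Lemma pullback_of_ex (b c d : C) (v : hom b d) (f : hom c d) :
  (exists a (f' : hom a b) (v' : hom a c),
     is_pullback_in (full_subcat C) v f f' v') -> pullback v f.
Proof.
move=> /cid[d' /cid[f' /cid[v' [_ _ comm univ]]]].
have med e (g : hom e b) (h : hom e c) (gh : v \oc g = f \oc h) :=
  cid (univ e g h I I gh).
refine (@Pullback _ _ _ v f d' f' v' comm
  (fun e g h gh => projT1 (med e g h gh)) _ _ _).
- by move=> e g h gh; case: (med e g h gh) => m [[]].
- by move=> e g h gh; case: (med e g h gh) => m [[]].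
- move=> e m m' ml mr.
  have gh : v \oc (f' \oc m) = f \oc (v' \oc m) by rewrite !compmA comm.
  have [n [_ nuniq]] := univ e _ _ I I gh.
  by rewrite -(nuniq m) // -(nuniq m').
Qed.

(** [mid_map] takes the commutativity proof of its square as an argument, so its sides cannot be
    rewritten in place. *)
Lemma mid_map_eq (w : wide_subcat C) (F : functorial_factorization w)
    (a b a' b' : C) (f : hom a b) (f' : hom a' b')
    (wf : msub w f) (wf' : msub w f') (g g' : hom a a') (h h' : hom b b')
    (e : f' \oc g = h \oc f) (e' : f' \oc g' = h' \oc f) :
  g = g' -> h = h' -> mid_map F wf wf' e = mid_map F wf wf' e'.
Proof. by move=> gg' hh'; subst g' h'; rewrite (Prop_irrelevance e e'). Qed.

End PushoutPullback.

(** * The homotopy inverse on categories of zigzags *)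

Section ZigzagPullback.
Variables (W : category) (F : functorial_factorization (full_subcat W)).
Let M (a b : W) (f : hom a b) : W := @mid _ _ F a b f I.
Let mu (a b : W) (f : hom a b) : hom a (M f) := @mid_u _ _ F a b f I.
Let mv (a b : W) (f : hom a b) : hom (M f) b := @mid_v _ _ F a b f I.
Variable PO : forall (a b c : W) (f : hom a b) (g : hom a c),
  pushout (mu f) g.
Variable PB : forall (a b c : W) (f : hom a b) (g : hom c b),
  pullback (mv f) g.
Variables b c' : W.

Section LadderMid.
Variables (x y : zigzag b c') (l : ladder x y).

Lemma ladder_mid_subproof : zz10 y \oc lad1 l = idm c' \oc zz10 x.
Proof. by rewrite lad10 comp1m. Qed.

Definition ladder_mid : hom (M (zz10 x)) (M (zz10 y)) :=
  @mid_map _ _ F _ _ _ _ _ _ I I _ _ ladder_mid_subproof.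

Lemma ladder_mid_u : ladder_mid \oc mu (zz10 x) = mu (zz10 y) \oc lad1 l.
Proof. exact: mid_map_u. Qed.

Lemma ladder_mid_v : mv (zz10 y) \oc ladder_mid = mv (zz10 x).
Proof. by rewrite /ladder_mid /mv mid_map_v comp1m. Qed.

Let P (x : zigzag b c') := PO (zz10 x) (zz12 x).

Lemma ladder_po_subproof :
  (po_l (P y) \oc ladder_mid) \oc mu (zz10 x) =
  (po_r (P y) \oc lad2 l) \oc zz12 x.
Proof. by rewrite -!compmA ladder_mid_u lad12 !compmA po_comm. Qed.

Definition ladder_po : hom (po_ob (P x)) (po_ob (P y)) :=
  po_med (P x) ladder_po_subproof.

Lemma ladder_po_l : ladder_po \oc po_l (P x) = po_l (P y) \oc ladder_mid.
Proof. exact: po_med_l. Qed.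

Lemma ladder_po_r : ladder_po \oc po_r (P x) = po_r (P y) \oc lad2 l.
Proof. exact: po_med_r. Qed.

Variables (c : W) (z : hom c c').
Let Q (x : zigzag b c') := PB (zz10 x) z.

Lemma ladder_pb_subproof :
  mv (zz10 y) \oc (ladder_mid \oc pb_l (Q x)) = z \oc pb_r (Q x).
Proof. by rewrite compmA ladder_mid_v pb_comm. Qed.

Definition ladder_pb : hom (pb_ob (Q x)) (pb_ob (Q y)) :=
  pb_med (Q y) ladder_pb_subproof.

Lemma ladder_pb_l : pb_l (Q y) \oc ladder_pb = ladder_mid \oc pb_l (Q x).
Proof. exact: pb_med_l. Qed.

Lemma ladder_pb_r : pb_r (Q y) \oc ladder_pb = pb_r (Q x).
Proof. exact: pb_med_r. Qed.

End LadderMid.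

Lemma ladder_mid1 (x : zigzag b c') : ladder_mid (ladder_id x) = idm _.
Proof. exact: mid_map1. Qed.

Lemma ladder_midM (x y t : zigzag b c') (m : ladder y t) (l : ladder x y) :
  ladder_mid (ladder_comp m l) = ladder_mid m \oc ladder_mid l.
Proof.
(* Functoriality produces the map over [idm c' \oc idm c'], still to be identified with the one over
   [idm c']. *)
have e : zz10 t \oc (lad1 m \oc lad1 l) = (idm c' \oc idm c') \oc zz10 x.
  by rewrite compmA !lad10 !comp1m.
rewrite -(@mid_mapM _ _ F _ _ _ _ _ _ _ _ _ I I I _ _ _ _
  (ladder_mid_subproof l) (ladder_mid_subproof m) e).
by apply: mid_map_eq; rewrite ?comp1m.
Qed.

Lemma ladder_po1 (x : zigzag b c') : ladder_po (ladder_id x) = idm _.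
Proof.
apply: po_inj; first by rewrite ladder_po_l ladder_mid1 compm1 comp1m.
by rewrite ladder_po_r compm1 comp1m.
Qed.

Lemma ladder_poM (x y t : zigzag b c') (m : ladder y t) (l : ladder x y) :
  ladder_po (ladder_comp m l) = ladder_po m \oc ladder_po l.
Proof.
apply: po_inj.
  by rewrite ladder_po_l ladder_midM -compmA ladder_po_l !compmA ladder_po_l.
by rewrite ladder_po_r -compmA ladder_po_r !compmA ladder_po_r.
Qed.

Definition zigzag_mid_ob (x : zigzag b c') : zigzag b c' :=
  Zigzag (po_r (PO (zz10 x) (zz12 x)) \oc zz32 x)
    (po_l (PO (zz10 x) (zz12 x))) (mv (zz10 x)).

Definition zigzag_mid : functor (zigzag_category b c') (zigzag_category b c').
Proof.
unshelve refine (@Functor (zigzag_category b c') (zigzag_category b c')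
  zigzag_mid_ob
  (fun x y l => @Ladder _ _ _ (zigzag_mid_ob x) (zigzag_mid_ob y)
    (ladder_po l) (ladder_mid l) _ _ _) _ _).
- by rewrite /= compmA ladder_po_r -compmA lad32.
- exact: ladder_po_l.
- exact: ladder_mid_v.
- by move=> x; apply: ladder_eq; [exact: ladder_po1|exact: ladder_mid1].
- by move=> x y t m l; apply: ladder_eq; [exact: ladder_poM|exact: ladder_midM].
Defined.

Definition zigzag_to_mid : nat_trans (id_functor _) zigzag_mid.
Proof.
unshelve refine (@NatTrans _ _ (id_functor _) zigzag_mid
  (fun x : zigzag b c' => @Ladder _ _ _ x (zigzag_mid x)
    (po_r (PO (zz10 x) (zz12 x))) (mu (zz10 x)) _ _ _) _).
- by [].
- by rewrite /= po_comm.
- exact: mid_fact.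
- move=> x y l; apply: ladder_eq; first by rewrite /= ladder_po_r.
  by rewrite /= ladder_mid_u.
Defined.

Variables (c : W) (z : hom c c').

Definition zigzag_pull_ob (x : zigzag b c') : zigzag b c :=
  Zigzag (po_r (PO (zz10 x) (zz12 x)) \oc zz32 x)
    (po_l (PO (zz10 x) (zz12 x)) \oc pb_l (PB (zz10 x) z))
    (pb_r (PB (zz10 x) z)).

Definition zigzag_pull : functor (zigzag_category b c') (zigzag_category b c).
Proof.
unshelve refine (@Functor (zigzag_category b c') (zigzag_category b c)
  zigzag_pull_ob
  (fun x y l => @Ladder _ _ _ (zigzag_pull_ob x) (zigzag_pull_ob y)
    (ladder_po l) (ladder_pb l z) _ _ _) _ _).
- by rewrite /= compmA ladder_po_r -compmA lad32.
- by rewrite /= compmA ladder_po_l -!compmA ladder_pb_l.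
- exact: ladder_pb_r.
- move=> x; apply: ladder_eq; first exact: ladder_po1.
  apply: pb_inj => /=; last by rewrite ladder_pb_r compm1.
  by rewrite ladder_pb_l ladder_mid1 comp1m compm1.
- move=> x y t m l; apply: ladder_eq; first exact: ladder_poM.
  apply: pb_inj => /=; last by rewrite compmA !ladder_pb_r.
  by rewrite compmA !ladder_pb_l ladder_midM -!compmA ladder_pb_l.
Defined.

Definition zigzag_unit :
  nat_trans (id_functor _) (comp_functor zigzag_pull (zigzag_post b z)).
Proof.
(* Z1 maps to Q through Z1 -> M and Z1 -> c; these agree over c' because the factored map is
   [z \oc zz10 x]. *)
have unit_pb (x : zigzag b c) :
  mv (z \oc zz10 x) \oc mu (z \oc zz10 x) = z \oc zz10 x by exact: mid_fact.
unshelve refine (@NatTrans _ _ (id_functor _)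
  (comp_functor zigzag_pull (zigzag_post b z))
  (fun x : zigzag b c =>
    @Ladder _ _ _ x (zigzag_pull (zigzag_post b z x))
      (po_r (PO (z \oc zz10 x) (zz12 x)))
      (pb_med (PB (z \oc zz10 x) z) (unit_pb x)) _ _ _) _).
- by [].
- by rewrite /= -compmA pb_med_l po_comm.
- exact: pb_med_r.
- move=> x y l; pose zl := zigzag_post_map z l.
  apply: ladder_eq => /=; first exact: esym (ladder_po_r zl).
  apply: pb_inj; rewrite !compmA.
    rewrite pb_med_l [X in _ = X \oc _](ladder_pb_l zl z) -compmA pb_med_l.
    exact: esym (ladder_mid_u zl).
  by rewrite pb_med_r [X in _ = X \oc _](ladder_pb_r zl z) pb_med_r lad10.
Defined.

Definition zigzag_post_pull_mid :
  nat_trans (comp_functor (zigzag_post b z) zigzag_pull) zigzag_mid.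
Proof.
unshelve refine (@NatTrans _ _ (comp_functor (zigzag_post b z) zigzag_pull)
  zigzag_mid
  (fun x : zigzag b c' =>
    @Ladder _ _ _ (zigzag_post b z (zigzag_pull x)) (zigzag_mid x)
      (idm _) (pb_l (PB (zz10 x) z)) _ _ _) _).
- by rewrite /= comp1m.
- by rewrite /= comp1m.
- by rewrite /= pb_comm.
- move=> x y l; apply: ladder_eq => /=; first by rewrite comp1m compm1.
  by rewrite ladder_pb_l.
Defined.

Lemma zigzag_post_weak (R : realType) : weak_equivalence R (zigzag_post b z).
Proof.
exact: weak_equivalence_zigzag zigzag_unit zigzag_post_pull_mid zigzag_to_mid.
Qed.

End ZigzagPullback.

(** * Pointwise calculus *)

Section Restriction.
Variables (C : category) (w U V : wide_subcat C).
Variable F : functorial_factorization w.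
Hypothesis calc : is_three_arrow_calculus U V F (full_subcat C).

(* An isomorphism is a pushout of an identity map, which lies in U. *)
Lemma iso_weak (a d : C) (f : hom a d) (g : hom d a) :
  f \oc g = idm d -> g \oc f = idm a -> msub w f.
Proof.
move=> fg gf; apply: (tac_Uw calc); apply: (tac_po_U calc (msub1 U a)).
split=> // e p q _ _; rewrite !compm1 => <-; exists (p \oc g); split.
  by rewrite -compmA gf compm1.
by move=> m [_ <- _]; rewrite -compmA fg compm1.
Qed.

Variable D : wide_subcat C.
Hypotheses (calcD : restricts_to U V F D)
  (wD : forall (a b : C) (f : hom a b), msub w f -> msub D f).

(** The calculus on D has some pushout inside D, which is also a pushout in C and hence isomorphic
    to P. The comparison isomorphisms are in w, so in D, and carry the closure properties over to
    P. *)
Lemma pushout_restrict (a b c : C) (u : hom a b) (f : hom a c)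
    (P : pushout u f) : msub U u -> msub D f ->
  [/\ msub D (po_l P), msub D (po_r P) &
    forall (e : C) (g : hom b e) (h : hom c e) (gh : g \oc u = h \oc f),
      msub D g -> msub D h -> msub D (po_med P gh)].
Proof.
move=> Uu Df; have [tacD full_po _] := calcD.
have [d [f' [u' po]]] := tac_po_ex tacD Uu Df.
have [_ _ comm univ] := full_po _ _ _ _ _ _ _ _ Uu po.
have [_ [Df' Du'] _ univD] := po.
have [psi [[_ psil psir] _]] := univ _ _ _ I I (po_comm P).
pose phi := po_med P comm.
have phi_psi : phi \oc psi = idm d.
  have [n [_ nuniq]] := univ _ _ _ I I comm.
  rewrite -(nuniq (idm d)) ?comp1m //; apply/esym/nuniq.
  by split=> //; rewrite -compmA ?psil ?psir ?po_med_l ?po_med_r.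
have psi_phi : psi \oc phi = idm _.
  by apply: po_inj; rewrite -compmA ?po_med_l ?po_med_r comp1m.
have Dphi : msub D phi by apply/wD/(iso_weak phi_psi psi_phi).
have Dpsi : msub D psi by apply/wD/(iso_weak psi_phi phi_psi).
split=> [||e g h gh Dg Dh].
- by rewrite -psil; exact: msubM.
- by rewrite -psir; exact: msubM.
- have [m [[Dm ml mr] _]] := univD _ _ _ Dg Dh gh.
  suff -> : po_med P gh = m \oc phi by exact: msubM.
  by apply: po_inj; rewrite -compmA !(po_med_l, po_med_r).
Qed.

Lemma pullback_restrict (b c d : C) (v : hom b d) (f : hom c d)
    (P : pullback v f) : msub V v -> msub D f ->
  [/\ msub D (pb_l P), msub D (pb_r P) &
    forall (e : C) (g : hom e b) (h : hom e c) (gh : v \oc g = f \oc h),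
      msub D g -> msub D h -> msub D (pb_med P gh)].
Proof.
move=> Vv Df; have [tacD _ full_pb] := calcD.
have [a [f' [v' pb]]] := tac_pb_ex tacD Vv Df.
have [_ _ comm univ] := full_pb _ _ _ _ _ _ _ _ Vv pb.
have [_ [Df' Dv'] _ univD] := pb.
have [psi [[_ psil psir] _]] := univ _ _ _ I I (pb_comm P).
pose phi := pb_med P comm.
have psi_phi : psi \oc phi = idm a.
  have [n [_ nuniq]] := univ _ _ _ I I comm.
  rewrite -(nuniq (idm a)) ?compm1 //; apply/esym/nuniq.
  by split=> //; rewrite compmA ?psil ?psir ?pb_med_l ?pb_med_r.
have phi_psi : phi \oc psi = idm _.
  by apply: pb_inj; rewrite compmA ?pb_med_l ?pb_med_r compm1.
have Dphi : msub D phi by apply/wD/(iso_weak phi_psi psi_phi).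
have Dpsi : msub D psi by apply/wD/(iso_weak psi_phi phi_psi).
split=> [||e g h gh Dg Dh].
- by rewrite -psil; exact: msubM.
- by rewrite -psir; exact: msubM.
- have [m [[Dm ml mr] _]] := univD _ _ _ Dg Dh gh.
  suff -> : pb_med P gh = phi \oc m by exact: msubM.
  by apply: pb_inj; rewrite compmA !(pb_med_l, pb_med_r).
Qed.

End Restriction.

(** * Pushouts, pullbacks and factorizations of relative functors *)

Section Pointwise.
Variables (k : nat) (X Z : krel_data k).
Variables (U V : wide_subcat Z) (F : functorial_factorization (wC Z)).
Hypotheses (calc : is_three_arrow_calculus U V F (full_subcat Z))
  (calc_w : restricts_to U V F (wC Z))
  (calc_v : forall i, restricts_to U V F (vC Z i))
  (wv : forall i (a b : Z) (f : hom a b), msub (wC Z) f -> msub (vC Z i) f).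
Notation W := (wfun_category X Z).

Section PointwisePushout.
Variables (A B E : relfunctor X Z) (s : wtrans A B) (t : wtrans A E).
Hypothesis Us : forall x, msub U (s x).

Let P x : pushout (s x) (t x) := pushout_of_ex (tac_po_ex calc (Us x) I).

Let P_w x := pushout_restrict calc calc_w (fun _ _ _ h => h) (P x) (Us x) (wtr_w t x).
Let P_v i x := pushout_restrict calc (calc_v i) (@wv i) (P x) (Us x)
  (wv i (wtr_w t x)).

Let pw_comm x y (f : hom x y) :
  (po_l (P y) \oc fmap B f) \oc s x = (po_r (P y) \oc fmap E f) \oc t x.
Proof. by rewrite -!compmA -!wtr_nat !compmA po_comm. Qed.

Definition pointwise_po_functor : functor X Z.
Proof.
refine (@Functor X Z (fun x => po_ob (P x))
  (fun x y f => po_med (P x) (pw_comm f)) _ _).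
- by move=> x; apply: po_inj; rewrite !(po_med_l, po_med_r) fmap1 compm1 comp1m.
- move=> x y z g f; apply: po_inj.
    by rewrite po_med_l -compmA po_med_l compmA po_med_l -compmA fmapM.
  by rewrite po_med_r -compmA po_med_r compmA po_med_r -compmA fmapM.
Defined.

(** Strictness enters here: the map between pushouts induced by f is a mediating map for composites
    in w, respectively in v_i, hence lies there itself. *)
Definition pointwise_po_ob : relfunctor X Z.
Proof.
refine (@RelFunctor _ _ _ pointwise_po_functor _ _).
- move=> x y f wf; have [_ _] := P_w x; apply; apply: msubM;
    try exact: rel_fun_w; by have [] := P_w y.
- move=> i x y f vf; have [_ _] := P_v i x; apply; apply: msubM;
    try exact: rel_fun_v; by have [] := P_v i y.
Defined.

Definition pointwise_pushout : @pushout W A B E s t.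
Proof.
have l_nat x y (f : hom x y) :
    po_l (P y) \oc fmap B f = fmap pointwise_po_ob f \oc po_l (P x).
  by rewrite po_med_l.
have r_nat x y (f : hom x y) :
    po_r (P y) \oc fmap E f = fmap pointwise_po_ob f \oc po_r (P x).
  by rewrite po_med_r.
have l_w x : msub (wC Z) (po_l (P x)) by have [] := P_w x.
have r_w x : msub (wC Z) (po_r (P x)) by have [] := P_w x.
pose l := @WTrans _ _ _ B pointwise_po_ob (fun x => po_l (P x)) l_nat l_w.
pose r := @WTrans _ _ _ E pointwise_po_ob (fun x => po_r (P x)) r_nat r_w.
have pointwise (Y : relfunctor X Z) (g : wtrans B Y) (h : wtrans E Y) :
    @compm W _ _ _ g s = @compm W _ _ _ h t ->
    forall x, g x \oc s x = h x \oc t x.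
  by move=> gh x; exact: (congr1 (fun m : wtrans A Y => m x) gh).
have med_nat (Y : relfunctor X Z) (g : wtrans B Y) (h : wtrans E Y)
    (gh : @compm W _ _ _ g s = @compm W _ _ _ h t) x y (f : hom x y) :
    po_med (P y) (pointwise Y g h gh y) \oc fmap pointwise_po_ob f =
    fmap Y f \oc po_med (P x) (pointwise Y g h gh x).
  apply: po_inj; rewrite -!compmA ?po_med_l ?po_med_r compmA ?po_med_l ?po_med_r;
    exact: wtr_nat.
have med_w (Y : relfunctor X Z) (g : wtrans B Y) (h : wtrans E Y)
    (gh : @compm W _ _ _ g s = @compm W _ _ _ h t) x :
    msub (wC Z) (po_med (P x) (pointwise Y g h gh x)).
  by have [_ _] := P_w x; apply; exact: wtr_w.
refine (@Pushout W A B E s t pointwise_po_ob l r _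
  (fun Y g h gh => @WTrans _ _ _ pointwise_po_ob Y
    (fun x => po_med (P x) (pointwise Y g h gh x))
    (med_nat Y g h gh) (med_w Y g h gh)) _ _ _).
- by apply: wtrans_eq => x; exact: po_comm.
- by move=> Y g h gh; apply: wtrans_eq => x; exact: po_med_l.
- by move=> Y g h gh; apply: wtrans_eq => x; exact: po_med_r.
- move=> Y m m' ml mr; apply: wtrans_eq => x; apply: po_inj.
    exact: (congr1 (fun n : wtrans B Y => n x) ml).
  exact: (congr1 (fun n : wtrans E Y => n x) mr).
Defined.

End PointwisePushout.

Section PointwisePullback.
Variables (A B E : relfunctor X Z) (s : wtrans B A) (t : wtrans E A).
Hypothesis Vs : forall x, msub V (s x).

Let P x : pullback (s x) (t x) := pullback_of_ex (tac_pb_ex calc (Vs x) I).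

Let P_w x := pullback_restrict calc calc_w (fun _ _ _ h => h) (P x) (Vs x) (wtr_w t x).
Let P_v i x := pullback_restrict calc (calc_v i) (@wv i) (P x) (Vs x)
  (wv i (wtr_w t x)).

Let pw_comm x y (f : hom x y) :
  s y \oc (fmap B f \oc pb_l (P x)) = t y \oc (fmap E f \oc pb_r (P x)).
Proof. by rewrite !compmA !wtr_nat -!compmA pb_comm. Qed.

Definition pointwise_pb_functor : functor X Z.
Proof.
refine (@Functor X Z (fun x => pb_ob (P x))
  (fun x y f => pb_med (P y) (pw_comm f)) _ _).
- by move=> x; apply: pb_inj; rewrite !(pb_med_l, pb_med_r) fmap1 compm1 comp1m.
- move=> x y z g f; apply: pb_inj.
    by rewrite pb_med_l compmA pb_med_l -compmA pb_med_l compmA fmapM.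
  by rewrite pb_med_r compmA pb_med_r -compmA pb_med_r compmA fmapM.
Defined.

Definition pointwise_pb_ob : relfunctor X Z.
Proof.
refine (@RelFunctor _ _ _ pointwise_pb_functor _ _).
- move=> x y f wf; have [_ _] := P_w y; apply; apply: msubM;
    try exact: rel_fun_w; by have [] := P_w x.
- move=> i x y f vf; have [_ _] := P_v i y; apply; apply: msubM;
    try exact: rel_fun_v; by have [] := P_v i x.
Defined.

Definition pointwise_pullback : @pullback W B E A s t.
Proof.
have l_nat x y (f : hom x y) :
    pb_l (P y) \oc fmap pointwise_pb_ob f = fmap B f \oc pb_l (P x).
  by rewrite pb_med_l.
have r_nat x y (f : hom x y) :
    pb_r (P y) \oc fmap pointwise_pb_ob f = fmap E f \oc pb_r (P x).
  by rewrite pb_med_r.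
have l_w x : msub (wC Z) (pb_l (P x)) by have [] := P_w x.
have r_w x : msub (wC Z) (pb_r (P x)) by have [] := P_w x.
pose l := @WTrans _ _ _ pointwise_pb_ob B (fun x => pb_l (P x)) l_nat l_w.
pose r := @WTrans _ _ _ pointwise_pb_ob E (fun x => pb_r (P x)) r_nat r_w.
have pointwise (Y : relfunctor X Z) (g : wtrans Y B) (h : wtrans Y E) :
    @compm W _ _ _ s g = @compm W _ _ _ t h ->
    forall x, s x \oc g x = t x \oc h x.
  by move=> gh x; exact: (congr1 (fun m : wtrans Y A => m x) gh).
have med_nat (Y : relfunctor X Z) (g : wtrans Y B) (h : wtrans Y E)
    (gh : @compm W _ _ _ s g = @compm W _ _ _ t h) x y (f : hom x y) :
    pb_med (P y) (pointwise Y g h gh y) \oc fmap Y f =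
    fmap pointwise_pb_ob f \oc pb_med (P x) (pointwise Y g h gh x).
  apply: pb_inj; rewrite !compmA ?pb_med_l ?pb_med_r -compmA ?pb_med_l ?pb_med_r;
    exact: wtr_nat.
have med_w (Y : relfunctor X Z) (g : wtrans Y B) (h : wtrans Y E)
    (gh : @compm W _ _ _ s g = @compm W _ _ _ t h) x :
    msub (wC Z) (pb_med (P x) (pointwise Y g h gh x)).
  by have [_ _] := P_w x; apply; exact: wtr_w.
refine (@Pullback W B E A s t pointwise_pb_ob l r _
  (fun Y g h gh => @WTrans _ _ _ Y pointwise_pb_ob
    (fun x => pb_med (P x) (pointwise Y g h gh x))
    (med_nat Y g h gh) (med_w Y g h gh)) _ _ _).
- by apply: wtrans_eq => x; exact: pb_comm.
- by move=> Y g h gh; apply: wtrans_eq => x; exact: pb_med_l.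
- by move=> Y g h gh; apply: wtrans_eq => x; exact: pb_med_r.
- move=> Y m m' ml mr; apply: wtrans_eq => x; apply: pb_inj.
    exact: (congr1 (fun n : wtrans Y B => n x) ml).
  exact: (congr1 (fun n : wtrans Y E => n x) mr).
Defined.

End PointwisePullback.

Section PointwiseFactorization.
Variables (A B : relfunctor X Z) (s : wtrans A B).

Definition pointwise_mid_functor : functor X Z.
Proof.
refine (@Functor X Z (fun x => mid F (wtr_w s x))
  (fun x y f => mid_map F (wtr_w s x) (wtr_w s y) (wtr_nat s f)) _ _).
- move=> x; have e : s x \oc idm (A x) = idm (B x) \oc s x.
    by rewrite compm1 comp1m.
  by rewrite -(mid_map1 F (wtr_w s x) e); apply: mid_map_eq; rewrite fmap1.
- move=> x y z g f.
  have e : s z \oc (fmap A g \oc fmap A f) = (fmap B g \oc fmap B f) \oc s x.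
    by rewrite -!fmapM wtr_nat.
  rewrite -(mid_mapM F (wtr_w s x) (wtr_w s y) (wtr_w s z) (wtr_nat s f)
    (wtr_nat s g) e).
  by apply: mid_map_eq; rewrite fmapM.
Defined.

Definition pointwise_mid : relfunctor X Z.
Proof.
refine (@RelFunctor _ _ _ pointwise_mid_functor _ _).
- move=> x y f wf; have [tac _ _] := calc_w.
  by apply: (tac_mid_map tac); exact: rel_fun_w.
- move=> i x y f vf; have [tac _ _] := calc_v i.
  by apply: (tac_mid_map tac); exact: rel_fun_v.
Defined.

Definition pointwise_mid_u : wtrans A pointwise_mid.
Proof.
refine (@WTrans _ _ _ A pointwise_mid (fun x => mid_u F (wtr_w s x)) _ _).
- by move=> x y f; rewrite /= mid_map_u.
- by move=> x; apply: (tac_Uw calc); exact: (tac_mid_u calc).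
Defined.

Definition pointwise_mid_v : wtrans pointwise_mid B.
Proof.
refine (@WTrans _ _ _ pointwise_mid B (fun x => mid_v F (wtr_w s x)) _ _).
- by move=> x y f; rewrite /= mid_map_v.
- by move=> x; apply: (tac_Vw calc); exact: (tac_mid_v calc).
Defined.

End PointwiseFactorization.

Definition pointwise_mid_map (A B A' B' : relfunctor X Z) (s : wtrans A B)
    (s' : wtrans A' B') (g : wtrans A A') (h : wtrans B B')
    (e : forall x, s' x \oc g x = h x \oc s x) :
  wtrans (pointwise_mid s) (pointwise_mid s').
Proof.
refine (@WTrans _ _ _ (pointwise_mid s) (pointwise_mid s')
  (fun x => mid_map F (wtr_w s x) (wtr_w s' x) (e x)) _ _).
- move=> x y f /=.
  (* By functoriality of the factorization, both sides of the naturality square are induced by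
     composite squares, whose sides agree by naturality of g and h. *)
  have e1 : s' y \oc (g y \oc fmap A f) = (h y \oc fmap B f) \oc s x.
    by rewrite compmA e -!compmA wtr_nat.
  have e2 : s' y \oc (fmap A' f \oc g x) = (fmap B' f \oc h x) \oc s x.
    by rewrite compmA wtr_nat -!compmA e.
  rewrite -(mid_mapM F _ (wtr_w s y) _ _ _ e1) -(mid_mapM F _ (wtr_w s' x) _ _ _ e2).
  by apply: mid_map_eq; rewrite wtr_nat.
- move=> x; have [tac _ _] := calc_w.
  by apply: (tac_mid_map tac); exact: wtr_w.
Defined.

Lemma wtrans_square (A B A' B' : relfunctor X Z) (f : wtrans A B)
    (f' : wtrans A' B') (g : wtrans A A') (h : wtrans B B') :
  @compm W _ _ _ f' g = @compm W _ _ _ h f ->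
  forall x, f' x \oc g x = h x \oc f x.
Proof. by move=> e x; exact: (congr1 (fun m : wtrans A B' => m x) e). Qed.

Definition pointwise_factorization : functorial_factorization (full_subcat W).
Proof.
refine (@FunctorialFactorization W (full_subcat W)
  (fun A B f _ => pointwise_mid f) (fun A B f _ => pointwise_mid_u f)
  (fun A B f _ => pointwise_mid_v f) _
  (fun A B A' B' f f' _ _ g h e => pointwise_mid_map (wtrans_square e))
  _ _ _ _).
- by move=> A B f _; apply: wtrans_eq => x; exact: mid_fact.
- by move=> A B A' B' f f' _ _ g h e; apply: wtrans_eq => x; exact: mid_map_u.
- by move=> A B A' B' f f' _ _ g h e; apply: wtrans_eq => x; exact: mid_map_v.
- by move=> A B f _ e; apply: wtrans_eq => x; exact: mid_map1.
- move=> A B A' B' A'' B'' f f' f'' _ _ _ g h g' h' e e' e''.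
  by apply: wtrans_eq => x; exact: mid_mapM.
Defined.

Lemma wfun_C3 (R : realType) : cat_property_C3 R W.
Proof.
move=> b c c' z; apply: (@zigzag_post_weak W pointwise_factorization).
- by move=> A B E f g; apply: pointwise_pushout => x; exact: (tac_mid_u calc (wtr_w f x)).
- by move=> A B E f g; apply: pointwise_pullback => x; exact: (tac_mid_v calc (wtr_w f x)).
Qed.

End Pointwise.

(** The case k = 0, where the category itself replaces [wp p Z]. All maps being weak, the
    factorization only has to be re-indexed to the full subcategory. *)
Lemma all_weak_C3 (R : realType) (C : category) (w U V : wide_subcat C)
    (F : functorial_factorization w) :
  is_three_arrow_calculus U V F (full_subcat C) ->
  (forall (a b : C) (f : hom a b), msub w f) -> cat_property_C3 R C.
Proof.
move=> calc wT b c c' z.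
pose F' : functorial_factorization (full_subcat C) :=
  @FunctorialFactorization C (full_subcat C)
    (fun a b f _ => mid F (wT a b f)) (fun a b f _ => mid_u F (wT a b f))
    (fun a b f _ => mid_v F (wT a b f)) (fun a b f _ => mid_fact F (wT a b f))
    (fun a b a' b' f f' _ _ g h e => mid_map F (wT a b f) (wT a' b' f') e)
    (fun a b a' b' f f' _ _ g h e => mid_map_u F (wT a b f) (wT a' b' f') e)
    (fun a b a' b' f f' _ _ g h e => mid_map_v F (wT a b f) (wT a' b' f') e)
    (fun a b f _ e => mid_map1 F (wT a b f) e)
    (fun a b a' b' a'' b'' f f' f'' _ _ _ g h g' h' e e' e'' =>
      mid_mapM F (wT a b f) (wT a' b' f') (wT a'' b'' f'') e e' e'').
apply: (@zigzag_post_weak C F') => [p q r f g|p q r f g].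
- by apply: pushout_of_ex; apply: (tac_po_ex calc) => //; exact: (tac_mid_u calc).
- by apply: pullback_of_ex; apply: (tac_pb_ex calc) => //; exact: (tac_mid_v calc).
Qed.

Theorem theorem8p4 (R : realType) (k : nat) (Z : krelcat k) :
  strict_three_arrow_calculus Z -> property_C3 R Z.
Proof.
case: k Z => [|k] Z; have [wv w0 _ _] := krelcatP Z;
  move=> [U [V [F [calc calc_w calc_v]]]].
  by apply: all_weak_C3 calc _; exact: w0.
by move=> p; exact: wfun_C3 calc calc_w calc_v wv R.
Qed.
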